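(* Let $\Bbbk$ be an algebraically closed field and $n\ge 1$. The degree function $\deg:\mathrm{Bir}(\mathbb{P}^n)\to\mathbb{N}$ is lower semicontinuous for the Zariski topology of $\mathrm{Bir}(\mathbb{P}^n)$, i.e. for all $d$ the subset $\mathrm{Bir}(\mathbb{P}^n)_{\le d}$ of birational maps of degree $\le d$ is closed. In particular, a subset $\mathcal{F}\subset\mathrm{Bir}(\mathbb{P}^n)$ is closed if and only if $\mathcal{F}\cap\mathrm{Bir}(\mathbb{P}^n)_{\le d}$ is closed for all $d>0$.
   Context: For an irreducible variety $X$ over $\Bbbk$, $\mathrm{Bir}(X)$ is the group of birational maps $X\dashrightarrow X$. For a variety $T$, a pseudo-automorphism of $T\times X$ over $T$ is a birational map $\varphi:T\times X\dashrightarrow T\times X$ for which there is a dense open $U\subset T\times X$ such that: $\varphi$ is defined on $U$; $U_t:=U\cap(\{t\}\times X)$ is dense in $\{t\}\times X$ for all $t\in T$; and there is a morphism $f:U\to X$ with $\varphi|_U(t,x)=(t,f(t,x))$ and $\varphi|_{U_t}:U_t\to\{t\}\times X$ a birational morphism for every $t$. The induced map $T\to\mathrm{Bir}(X)$, $t\mapsto\varphi_t$ (also written $\varphi(t)$), is called a morphism from $T$ to $\mathrm{Bir}(X)$. Zariski topology on $\mathrm{Bir}(X)$: $\mathcal{F}\subset\mathrm{Bir}(X)$ is closed iff $\varphi^{-1}(\mathcal{F})$ is closed in $T$ for every variety $T$ and every morphism $\varphi:T\to\mathrm{Bir}(X)$ (it is equivalent to use only affine irreducible $T$). The degree $\deg(f)$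 of $f\in\mathrm{Bir}(\mathbb{P}^n)$ is the common degree of homogeneous polynomials $f_0,\dots,f_n\in\Bbbk[x_0,\dots,x_n]$ without nontrivial common factor such that $f=(f_0:\cdots:f_n)$. *)

(* Defs.v *)
From HB Require Import structures.
From mathcomp Require Import all_boot all_order all_algebra.
From mathcomp Require Import boolp classical_sets.
From mathcomp Require Import mpoly.

Set Implicit Arguments.
Unset Strict Implicit.
Unset Printing Implicit Defensive.

Import GRing.Theory.
Local Open Scope classical_set_scope.
Local Open Scope ring_scope.

Definition alg_set (k : closedFieldType) (m : nat) (C : set 'rV[k]_m) : Prop :=
  exists S : set {mpoly k[m]},
    C = [set x | forall p, S p -> p.@[x ord0] = 0].

(* Varieties over k in the sense of Serre: a set of points covered by finitely *)
(* many affine charts, each one identified with a closed subset of some affine *)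
(* space.  [atlas] is the data, [is_variety] the axioms.  The functions        *)
(* [chart i] are total, but only their values on [cdom i] are meaningful.      *)
Record atlas (k : closedFieldType) := Atlas {
  pt :> Type;
  idx : finType;
  dim : idx -> nat;
  cdom : idx -> set pt;
  chart : forall i : idx, pt -> 'rV[k]_(dim i) }.

Arguments cdom {k} a i _.
Arguments chart {k} a i _.

Definition zclosed (k : closedFieldType) (T : atlas k) (F : set T) : Prop :=
  forall i : idx T, exists2 C : set 'rV[k]_(dim i),
    alg_set C & forall x, cdom T i x -> (F x <-> C (chart T i x)).

Definition zopen (k : closedFieldType) (T : atlas k) (W : set T) : Prop :=
  zclosed (~` W).

Definition zdense (k : closedFieldType) (T : atlas k) (W : set T) : Prop :=
  forall V : set T, zopen V -> V !=set0 -> (V `&` W) !=set0.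

(* h is a regular function on the open set W: near every point it is a         *)
(* quotient of polynomials in the chart coordinates.                           *)
Definition regular_fun (k : closedFieldType) (T : atlas k) (W : set T)
    (h : T -> k) : Prop :=
  forall (i : idx T) (x : T), W x -> cdom T i x ->
  exists p q : {mpoly k[dim i]},
    q.@[chart T i x ord0] != 0 /\
    forall y : T, W y -> cdom T i y -> q.@[chart T i y ord0] != 0 ->
      h y = p.@[chart T i y ord0] / q.@[chart T i y ord0].

(* f restricts to a morphism W -> Y, for W open in T *)
Definition regular_map (k : closedFieldType) (T Y : atlas k) (W : set T)
    (f : T -> Y) : Prop :=
  forall j : idx Y,
    zopen (W `&` f @^-1` cdom Y j) /\
    forall l : 'I_(dim j),
      regular_fun (W `&` f @^-1` cdom Y j) (fun x => chart Y j (f x) ord0 l).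

(* The last axiom is separatedness: the diagonal is closed. *)
Record is_variety (k : closedFieldType) (T : atlas k) : Prop := IsVariety {
  charts_cover : forall x : T, exists i, cdom T i x;
  charts_inj : forall i x y, cdom T i x -> cdom T i y ->
    chart T i x = chart T i y -> x = y;
  charts_affine : forall i, alg_set (chart T i @` cdom T i);
  charts_open : forall i, zopen (cdom T i);
  charts_regular : forall i (l : 'I_(dim i)),
    regular_fun (cdom T i) (fun x => chart T i x ord0 l);
  charts_separated : forall i j,
    alg_set [set row_mx (chart T i x) (chart T j x)
            | x in cdom T i `&` cdom T j] }.

Definition prod_atlas (k : closedFieldType) (T X : atlas k) : atlas k :=
  @Atlas k (T * X)%type (idx T * idx X)%type
    (fun ij => (dim ij.1 + dim ij.2)%N)
    (fun ij => [set tx | cdom T ij.1 tx.1 /\ cdom X ij.2 tx.2])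
    (fun ij tx => row_mx (chart T ij.1 tx.1) (chart X ij.2 tx.2)).

Definition line (k : closedFieldType) (n : nat) : Type :=
  {L : {vspace 'rV[k]_n.+1} | \dim L == 1%N}.

(* P^n: lines in k^(n+1); the i-th chart is (x_0 : ... : x_n) |->              *)
(* (x_j / x_i)_{j <> i} on x_i <> 0, where x is any nonzero vector of the line *)
Definition proj (k : closedFieldType) (n : nat) : atlas k :=
  @Atlas k (line k n) 'I_n.+1 (fun=> n)
    (fun i L => vpick (sval L) ord0 i != 0)
    (fun i L => \row_(j < n)
       (vpick (sval L) ord0 (lift i j) / vpick (sval L) ord0 i)).

(* Representatives (U, f) of rational maps X --> X; f is only meaningful on U *)
Definition is_rational (k : closedFieldType) (X : atlas k)
    (p : set X * (X -> X)) : Prop :=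
  [/\ zopen p.1, zdense p.1 & regular_map p.1 p.2].

Definition rat_eq (k : closedFieldType) (X : atlas k)
    (p q : set X * (X -> X)) : Prop :=
  exists W : set X, [/\ zopen W, zdense W, W `<=` p.1 `&` q.1 &
    forall x, W x -> p.2 x = q.2 x].

(* (U, f) restricts to an isomorphism between dense open subsets of X.  This   *)
(* form also makes sense for reducible X, as needed for T x X.                 *)
Definition is_birational (k : closedFieldType) (X : atlas k)
    (p : set X * (X -> X)) : Prop :=
  is_rational p /\
  exists (U : set X) (q : set X * (X -> X)),
    [/\ [/\ zopen U, zdense U & U `<=` p.1], is_rational q,
      forall x, U x -> q.1 (p.2 x) /\ q.2 (p.2 x) = x &
      forall y, q.1 y -> U (q.2 y) /\ p.2 (q.2 y) = y].

Record Bir (k : closedFieldType) (X : atlas k) := MkBir {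
  bir_class :> set (set X * (X -> X));
  bir_classP : exists2 p, is_birational p &
    bir_class = [set q | is_rational q /\ rat_eq p q] }.

(* U_t, with {t} x X identified with X *)
Definition slice (k : closedFieldType) (T X : atlas k)
    (U : set (prod_atlas T X)) (t : T) : set X := [set x | U (t, x)].

(* phi is a pseudo-automorphism of T x X over T, given on U by                 *)
(* (t, x) |-> (t, f (t, x))                                                    *)
Definition pseudo_automorphism_on (k : closedFieldType) (T X : atlas k)
    (phi : Bir (prod_atlas T X)) (U : set (prod_atlas T X))
    (f : prod_atlas T X -> X) : Prop :=
  [/\ zopen U /\ zdense U,
      forall t : T, zdense (slice U t),
      regular_map U f,
      bir_class phi (U, fun tx => (tx.1, f tx)) &
      forall t : T, is_birational (slice U t, fun x => f (t, x))].

Definition bir_morphism (k : closedFieldType) (T X : atlas k)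
    (theta : T -> Bir X) : Prop :=
  exists (phi : Bir (prod_atlas T X)) (U : set (prod_atlas T X))
         (f : prod_atlas T X -> X),
    pseudo_automorphism_on phi U f /\
    forall t : T, bir_class (theta t) (slice U t, fun x => f (t, x)).

Definition bir_closed (k : closedFieldType) (X : atlas k) (F : set (Bir X)) :
    Prop :=
  forall (T : atlas k) (theta : T -> Bir X),
    is_variety T -> bir_morphism theta -> zclosed (theta @^-1` F).

(* f = (F_0 : ... : F_n) on a dense open subset of P^n *)
Definition given_by (k : closedFieldType) (n : nat) (f : Bir (proj k n))
    (F : 'I_n.+1 -> {mpoly k[n.+1]}) : Prop :=
  exists (U : set (proj k n)) (g : proj k n -> proj k n),
    bir_class f (U, g) /\
    forall L : proj k n, U L -> forall v : 'rV[k]_n.+1,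
      v \in sval L -> v != 0 ->
      let w := \row_i (F i).@[v ord0] in w != 0 /\ w \in sval (g L).

Definition no_common_factor (k : closedFieldType) (m : nat) (I : finType)
    (F : I -> {mpoly k[m]}) : Prop :=
  forall h : {mpoly k[m]}, (forall i, exists q, F i = h * q) ->
    exists2 c : k, c != 0 & h = c%:MP.

Definition has_degree (k : closedFieldType) (n : nat) (f : Bir (proj k n))
    (d : nat) : Prop :=
  exists F : 'I_n.+1 -> {mpoly k[n.+1]},
    [/\ forall i, F i \is d.-homog, no_common_factor F & given_by f F].

(* [has_degree f d] holds for exactly one d, so the default 0 is never used. *)
Definition bir_deg (k : closedFieldType) (n : nat) (f : Bir (proj k n)) : nat :=
  xget 0%N [set d | has_degree f d].

Definition Bir_le (k : closedFieldType) (n d : nat) : set (Bir (proj k n)) :=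
  [set f | (bir_deg f <= d)%N].
Arguments Bir_le : clear implicits.

(* Products of varieties and P^n, used above only as atlases, do satisfy the   *)
(* axioms: see [prod_is_variety] and [proj_is_variety].                        *)
Section AlgSets.
Variable k : closedFieldType.

Definition poly_map (m d : nat) (f : 'rV[k]_m -> 'rV[k]_d) : Prop :=
  forall l, exists p : {mpoly k[m]}, forall x, f x ord0 l = p.@[x ord0].

Lemma alg_setI m (C D : set 'rV[k]_m) :
  alg_set C -> alg_set D -> alg_set (C `&` D).
Proof.
move=> [S ->] [S' ->]; exists (S `|` S'); apply/seteqP; split => x /=.
  by move=> [h h'] p [Sp|Sp]; [apply: h | apply: h'].
by move=> h; split=> p hp; apply: h; [left | right].
Qed.

Lemma alg_setU m (C D : set 'rV[k]_m) :
  alg_set C -> alg_set D -> alg_set (C `|` D).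
Proof.
move=> [S ->] [S' ->].
exists [set r | exists p q, [/\ S p, S' q & r = p * q]].
apply/seteqP; split => x /=.
  case=> h _ [p [q [hp hq ->]]]; rewrite mevalM.
    by rewrite (h _ hp) mul0r.
  by rewrite (h _ hq) mulr0.
move=> h; apply: contrapT => /not_orP[/existsNP[p /not_implyP[hp xp]]
  /existsNP[q /not_implyP[hq xq]]].
have /eqP := h (p * q) (ex_intro _ p (ex_intro _ q (And3 hp hq erefl))).
by rewrite mevalM mulf_eq0 => /orP[] /eqP.
Qed.

Lemma alg_setT m : alg_set [set: 'rV[k]_m].
Proof. by exists set0; apply/esym; rewrite -subTset => x _ p. Qed.

Lemma alg_set1 m (p : {mpoly k[m]}) : alg_set [set x | p.@[x ord0] = 0].
Proof.
exists [set p]; apply/seteqP; split => x /=; last by move=> h; apply: h.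
by move=> h q ->.
Qed.

Lemma poly_map_comp m d (f : 'rV[k]_m -> 'rV[k]_d) (p : {mpoly k[d]}) :
  poly_map f -> exists q : {mpoly k[m]}, forall x, p.@[f x ord0] = q.@[x ord0].
Proof.
move=> /choice[P hP]; exists (p \mPo [tuple P i | i < d]) => x.
by rewrite comp_mpoly_meval; apply: meval_eq => i; rewrite tnth_mktuple.
Qed.

Lemma alg_set_preimage m d (f : 'rV[k]_m -> 'rV[k]_d) C :
  poly_map f -> alg_set C -> alg_set (f @^-1` C).
Proof.
move=> hf [S ->].
exists [set q | exists2 p, S p & forall x, p.@[f x ord0] = q.@[x ord0]].
apply/seteqP; split => x /=; first by move=> h q [p Sp <-]; apply: h.
by move=> h p hp; have [q hq] := poly_map_comp p hf; rewrite hq; apply: h; exists p.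
Qed.

Lemma poly_map_lsub m d : poly_map (@lsubmx k 1 m d).
Proof. by move=> l; exists 'X_(lshift d l) => x; rewrite mxE mevalXU. Qed.

Lemma poly_map_rsub m d : poly_map (@rsubmx k 1 m d).
Proof. by move=> l; exists 'X_(rshift m l) => x; rewrite mxE mevalXU. Qed.

Lemma poly_map_trans m d e (f : 'rV[k]_m -> 'rV[k]_d) (g : 'rV[k]_d -> 'rV[k]_e) :
  poly_map f -> poly_map g -> poly_map (fun x => g (f x)).
Proof.
move=> hf hg l; have [p hp] := hg l; have [q hq] := poly_map_comp p hf.
by exists q => x; rewrite hp hq.
Qed.

Lemma poly_map_row m d e (f : 'rV[k]_m -> 'rV[k]_d) (g : 'rV[k]_m -> 'rV[k]_e) :
  poly_map f -> poly_map g -> poly_map (fun x => row_mx (f x) (g x)).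
Proof.
move=> hf hg l; rewrite -[l]splitK; case: (split l) => j /=.
  by have [p hp] := hf j; exists p => x; rewrite row_mxEl.
by have [p hp] := hg j; exists p => x; rewrite row_mxEr.
Qed.

End AlgSets.

Lemma prod_is_variety (k : closedFieldType) (T X : atlas k) :
  is_variety T -> is_variety X -> is_variety (prod_atlas T X).
Proof.
move=> hT hX; split.
- move=> [t x]; have [i hi] := charts_cover hT t.
  by have [j hj] := charts_cover hX x; exists (i, j).
- move=> [i j] [t x] [t' x'] /= [ht hx] [ht' hx'] /eq_row_mx[e e'].
  by congr pair; [apply: (charts_inj hT) e | apply: (charts_inj hX) e'].
- move=> [i j] /=.
  have -> : [set row_mx (chart T i tx.1) (chart X j tx.2) |
      tx in [set tx : T * X | cdom T i tx.1 /\ cdom X j tx.2]] =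
      (lsubmx @^-1` (chart T i @` cdom T i)) `&`
      (rsubmx @^-1` (chart X j @` cdom X j)).
    apply/seteqP; split => [_ [[t x] /= [ht hx] <-]|w /= [[t ht e] [x hx e']]].
      by split; [exists t; rewrite ?row_mxKl | exists x; rewrite ?row_mxKr].
    by exists (t, x); rewrite //= e e' hsubmxK.
  by apply: alg_setI; apply: alg_set_preimage;
    [exact: poly_map_lsub|exact: charts_affine|exact: poly_map_rsub|exact: charts_affine].
- move=> [i j] [i' j'] /=.
  have [C hC eC] := charts_open hT i i'; have [D hD eD] := charts_open hX j j'.
  exists ((lsubmx @^-1` C) `|` (rsubmx @^-1` D)).
    by apply: alg_setU; apply: alg_set_preimage => //;
      [exact: poly_map_lsub|exact: poly_map_rsub].
  move=> [t x] /= [ht hx]; rewrite row_mxKl row_mxKr -eC // -eD //=.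
  by split; [move=> /not_andP | move=> h; apply/not_andP].
- move=> [i j] /= l [i' j'] [t x] /= [ht hx] [ht' hx'].
  rewrite -[l]splitK; case: (split l) => {l} l /=.
    have [p [q [q0 pq]]] := charts_regular hT l ht ht'.
    have [P hP] := poly_map_comp p (@poly_map_lsub k (dim i') (dim j')).
    have [Q hQ] := poly_map_comp q (@poly_map_lsub k (dim i') (dim j')).
    exists P, Q; rewrite -hQ row_mxKl; split=> // y [hy _] [hy' _].
    by rewrite -hQ -hP row_mxKl row_mxEl => /pq ->.
  have [p [q [q0 pq]]] := charts_regular hX l hx hx'.
  have [P hP] := poly_map_comp p (@poly_map_rsub k (dim i') (dim j')).
  have [Q hQ] := poly_map_comp q (@poly_map_rsub k (dim i') (dim j')).
  exists P, Q; rewrite -hQ row_mxKr; split=> // y [_ hy] [_ hy'].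
  by rewrite -hQ -hP row_mxKr row_mxEr => /pq ->.
move=> [i j] [i' j'] /=.
pose f (w : 'rV[k]_((dim i + dim j) + (dim i' + dim j'))) :=
  row_mx (lsubmx (lsubmx w)) (lsubmx (rsubmx w)).
pose g (w : 'rV[k]_((dim i + dim j) + (dim i' + dim j'))) :=
  row_mx (rsubmx (lsubmx w)) (rsubmx (rsubmx w)).
set A := (X in alg_set X).
have -> : A = (f @^-1` [set row_mx (chart T i x) (chart T i' x)
            | x in cdom T i `&` cdom T i']) `&`
   (g @^-1` [set row_mx (chart X j x) (chart X j' x)
            | x in cdom X j `&` cdom X j']).
  apply/seteqP; split => [_ [[t x] /= [[ht hx] [ht' hx']] <-]|].
    by split; [exists t|exists x]; rewrite //= /f /g ?row_mxKl ?row_mxKr ?row_mxKl ?row_mxKr.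
  move=> w /= [[t [ht ht'] /eq_row_mx[e1 e2]] [x [hx hx'] /eq_row_mx[e3 e4]]].
  by exists (t, x) => //=; rewrite e1 e2 e3 e4 !hsubmxK.
apply: alg_setI; apply: alg_set_preimage; try exact: charts_separated.
  apply: poly_map_row; (apply: poly_map_trans; last exact: poly_map_lsub);
  [exact: poly_map_lsub|exact: poly_map_rsub].
apply: poly_map_row; (apply: poly_map_trans; last exact: poly_map_rsub);
[exact: poly_map_lsub|exact: poly_map_rsub].
Qed.

Section ProjectiveSpace.
Variables (k : closedFieldType) (n : nat).

Let rep (L : line k n) : 'rV[k]_n.+1 := vpick (sval L).

Let homc (i : 'I_n.+1) (a : 'I_n.+1) : {mpoly k[n]} :=
  if unlift i a is Some j then 'X_j else 1.

Let hom (i : 'I_n.+1) (u : 'rV[k]_n) : 'rV[k]_n.+1 :=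
  \row_a (homc i a).@[u ord0].

Lemma line_rep (L : line k n) : sval L = <[rep L]>%VS /\ rep L != 0.
Proof.
have L1 := svalP L.
have r0 : rep L != 0.
  by apply/negP; rewrite vpick0 => /eqP e; rewrite e dimv0 in L1.
split=> //; apply/esym/eqP; rewrite eqEdim -memvE memv_pick /=.
by rewrite dim_vline r0 (eqP L1).
Qed.

Lemma line_of (v : 'rV[k]_n.+1) : v != 0 ->
  exists L : line k n, exists2 c, c != 0 & rep L = c *: v.
Proof.
move=> v0; have v1 : \dim <[v]>%VS == 1%N by rewrite dim_vline v0.
pose L : line k n :=
  exist (fun L : {vspace 'rV[k]_n.+1} => \dim L == 1%N) <[v]>%VS v1.
exists L.
have /vlineP[c e] : rep L \in <[v]>%VS by exact: memv_pick.
exists c => //; apply/negP => /eqP c0.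
by have [_] := line_rep L; rewrite e c0 scale0r eqxx.
Qed.

Lemma line_eq (L M : line k n) c : rep L = c *: rep M -> L = M.
Proof.
move=> e; have [eL L0] := line_rep L; have [eM M0] := line_rep M.
apply: val_inj => /=; apply/eqP; rewrite eqEdim.
rewrite (eqP (svalP L)) (eqP (svalP M)) leqnn andbT.
by rewrite [X in (X <= _)%VS]eL -memvE e memvZ // memv_pick.
Qed.

Lemma hom_chart i (L : proj k n) : cdom (proj k n) i L ->
  hom i (chart (proj k n) i L) = (rep L ord0 i)^-1 *: rep L.
Proof.
move=> /= h; apply/rowP => a; rewrite !mxE /homc; case: unliftP => [j|] ->.
  by rewrite mevalXU mxE mulrC.
by rewrite meval1 mulVf.
Qed.

Lemma homi i u : hom i u ord0 i = 1.
Proof. by rewrite mxE /homc unlift_none meval1. Qed.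

Lemma hom_neq0 i u : hom i u != 0.
Proof.
by apply/eqP => /rowP /(_ i); rewrite homi mxE => /eqP; rewrite oner_eq0.
Qed.

Lemma hom_lift i u j : hom i u ord0 (lift i j) = u ord0 j.
Proof. by rewrite mxE /homc liftK mevalXU. Qed.

Lemma proj_is_variety : is_variety (proj k n).
Proof.
split.
- move=> L /=; have [_ /eqP L0] := line_rep L; apply: contrapT => h.
  apply: L0; apply/rowP => i; rewrite mxE; apply: contrapT => /eqP hi.
  by apply: h; exists i.
- move=> i L M hL hM e.
  have := hom_chart hL; rewrite e hom_chart // => /(congr1 ( *:%R (rep L ord0 i))).
  by rewrite !scalerA mulfV // scale1r => /esym /line_eq.
- move=> i; set A := (X in alg_set X); suff -> : A = setT by exact: alg_setT.
  apply/seteqP; split => // u _; have [L [c c0 e]] := line_of (hom_neq0 i u).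
  have Li : rep L ord0 i = c by rewrite e mxE homi mulr1.
  exists L; first by rewrite /= -/(rep L) Li.
  apply/rowP => j; rewrite !mxE -/(rep L) Li e mxE hom_lift.
  by rewrite mulrAC mulfV // mul1r.
- move=> i j /=; exists [set u | (homc j i).@[u ord0] = 0]; first exact: alg_set1.
  move=> L hL /=; have := hom_chart hL => /rowP /(_ i); rewrite [LHS]mxE => ->.
  rewrite mxE; split.
    by move=> /negP; rewrite negbK => /eqP e; rewrite /rep e mulr0.
  move=> /eqP; rewrite mulf_eq0 invr_eq0 (negPf hL : (rep L ord0 j == 0) = false) /=.
  by move=> /eqP e; rewrite -/(rep L) e eqxx.
- move=> i l j L hi hj; exists (homc j (lift i l)), (homc j i).
  have E M a : cdom (proj k n) j M -> (homc j a).@[chart (proj k n) j M ord0] =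
      (rep M ord0 j)^-1 * rep M ord0 a.
    by move=> hM; have := hom_chart hM => /rowP /(_ a); rewrite [LHS]mxE [RHS]mxE.
  rewrite E // mulf_neq0 ?invr_eq0 //; split=> // M hM hM' _.
  rewrite !E // mxE -/(rep M) invfM invrK.
  have M0 : rep M ord0 j != 0 by [].
  by rewrite mulrACA mulVf // mul1r.
move=> i j.
pose w1 (w : 'rV[k]_(n + n)) : 'rV[k]_n := lsubmx w.
pose w2 (w : 'rV[k]_(n + n)) : 'rV[k]_n := rsubmx w.
pose D := [set w : 'rV[k]_(n + n) | forall a b,
  hom i (w1 w) ord0 a * hom j (w2 w) ord0 b =
  hom i (w1 w) ord0 b * hom j (w2 w) ord0 a].
set A := (X in alg_set X); have -> : A = D.
  apply/seteqP; split => [_ [L [hi hj] <-] a b|w Dw].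
    rewrite /w1 /w2 row_mxKl row_mxKr !hom_chart // !mxE.
    by rewrite mulrACA [RHS]mulrACA [rep L ord0 a * _]mulrC.
  have [L [c c0 e]] := line_of (hom_neq0 i (w1 w)).
  have Li : rep L ord0 i = c by rewrite e mxE homi mulr1.
  have hij : hom i (w1 w) ord0 j != 0.
    apply/eqP => h; have := Dw i j; rewrite !homi h mul0r mulr1.
    by move/eqP; rewrite oner_eq0.
  have Lj : rep L ord0 j = c * hom i (w1 w) ord0 j by rewrite e mxE.
  exists L; first by split; rewrite /= -/(rep L) ?Li // Lj mulf_neq0.
  rewrite -[w]hsubmxK; congr row_mx; apply/rowP => l; rewrite mxE -/(rep L).
    by rewrite Li e mxE hom_lift mulrAC mulfV // mul1r.
  rewrite Lj e [X in X / _]mxE; have := Dw (lift j l) j.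
  rewrite homi mulr1 => ->; rewrite hom_lift mulrA mulrAC mulfV ?mul1r //.
  exact: mulf_neq0.
pose P (a b : 'I_n.+1) : {mpoly k[n + n]} :=
  (homc i a \mPo [tuple 'X_(lshift n l) | l < n]) *
  (homc j b \mPo [tuple 'X_(rshift n l) | l < n]).
have PE a b (w : 'rV[k]_(n + n)) : (P a b).@[w ord0] =
    hom i (w1 w) ord0 a * hom j (w2 w) ord0 b.
  rewrite mevalM !comp_mpoly_meval !mxE; congr (_ * _);
  by apply: meval_eq => l; rewrite tnth_mktuple mevalXU mxE.
exists [set p | exists a b, p = P a b - P b a].
apply/seteqP; split => w /=.
  by move=> Dw _ [a [b ->]]; rewrite mevalB !PE Dw subrr.
move=> h a b; have := h _ (ex_intro _ a (ex_intro _ b erefl)).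
by rewrite mevalB !PE => /eqP; rewrite subr_eq0 => /eqP.
Qed.

End ProjectiveSpace.

(* Main.v *)
(* Near a point t0 of T, a morphism theta : T -> Bir(P^n) is given by         *)
(* homogeneous polynomials F_i(t, x) of a fixed degree e whose coefficients   *)
(* are polynomials in a chart of T and which do not all vanish at t0: clear   *)
(* denominators in a local expression at one point (t0, x0), and use that     *)
(* nonempty open subsets of P^n are dense. As polynomial rings are factorial, *)
(* deg theta(t) <= d holds iff some nonzero family G of forms of degree d     *)
(* satisfies F_i(t) G_j = F_j(t) G_i. This is a linear system in the          *)
(* coefficients of G, so it is solvable iff certain minors, polynomial in t,  *)
(* vanish. Moreover deg theta(t) <= e near t0, so by the Hilbert basis        *)
(* theorem the degree is bounded on each chart, whence the second assertion.  *)

From Pilot Require Import Defs.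
From mathcomp Require Import all_boot all_order all_algebra.
From mathcomp Require Import boolp classical_sets.
From mathcomp Require Import mpoly zify.

Set Implicit Arguments.
Unset Strict Implicit.
Unset Printing Implicit Defensive.

Import GRing.Theory Pilot.Defs.
Local Open Scope classical_set_scope.
Local Open Scope ring_scope.

(** * Unique factorization *)

(** Near a point of a chart of T, a morphism [theta] is represented by forms F_i(t, x) of one degree
    e with coefficients polynomial in t ([bir_morphism_local], from [local_presentation]). Since
    nonempty open subsets of P^n are dense, a nonzero family G represents the same map iff F_i G_j =
    F_j G_i for all i, j. As polynomial rings are factorial, every representative is a multiple of
    one without common factor, which therefore has least degree. Hence deg theta(t) <= d iff these
    equations have a nonzero solution G of degree d ([bir_degP]). They are linear in the
    coefficients of G, so this amounts to the vanishing of minors polynomial in t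
    ([alg_set_proportional]); and closedness is a local property ([zclosed_local]).

    For the second assertion, the F_i themselves show deg theta(t) <= e near the point. Hilbert's
    basis theorem turns these local bounds into one bound per chart ([bir_deg_bounded]). On a chart,
    the preimage of a set is then the preimage of its part of bounded degree. *)

Section UniqueFactorization.
Variable R : idomainType.
Implicit Types a b p : R.

Definition divides a b := exists c, b = a * c.

Definition prime_elt p :=
  [/\ p != 0, p \isn't a GRing.unit &
      forall a b, divides p (a * b) -> divides p a \/ divides p b].

Definition irreducible_elt p :=
  [/\ p != 0, p \isn't a GRing.unit &
      forall a b, p = a * b -> a \is a GRing.unit \/ b \is a GRing.unit].

Definition prime_factored a := exists u (s : seq R),
  [/\ u \is a GRing.unit, {in s, forall p, prime_elt p} &
      a = u * \prod_(p <- s) p].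

Definition factorial_ring := forall a, a != 0 -> prime_factored a.

Lemma prime_factoredM a b :
  prime_factored a -> prime_factored b -> prime_factored (a * b).
Proof.
move=> [u [s [Uu hs ->]]] [v [r [Uv hr ->]]].
exists (u * v), (s ++ r); split; first by rewrite unitrM Uu.
  by move=> p; rewrite mem_cat => /orP[/hs|/hr].
by rewrite big_cat mulrACA.
Qed.

Lemma prime_factored_prime p : prime_elt p -> prime_factored p.
Proof.
move=> hp; exists 1, [:: p]; split; first exact: unitr1.
  by move=> q; rewrite inE => /eqP ->.
by rewrite big_seq1 mul1r.
Qed.

Lemma prime_dividesN_unit p u :
  prime_elt p -> u \is a GRing.unit -> ~ divides p u.
Proof.
move=> [_ Np _] Uu [c e]; move: Uu; rewrite e unitrM => /andP[Up _].
by rewrite Up in Np.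
Qed.

Lemma prime_divides_prime p q : prime_elt p -> prime_elt q -> divides p q ->
  exists2 w, w \is a GRing.unit & q = p * w.
Proof.
move=> [p0 Np _] [q0 _ hq] [w e]; exists w => //.
have [|[y ey]|[y ey]] := hq p w; first by exists 1; rewrite mulr1.
  apply/unitrPr; exists y; apply: (mulfI q0).
  by rewrite mulr1 mulrCA -ey mulrC.
case/negP: Np; apply/unitrPr; exists y; apply: (mulfI q0).
by rewrite mulr1 mulrCA -ey -e.
Qed.

(** Dividing by p removes exactly one prime, up to a unit. The exact count serves as the inner
    induction measure in [factorial_poly]. *)
Lemma prime_factor_cancel p x u (s : seq R) : prime_elt p ->
  u \is a GRing.unit -> {in s, forall q, prime_elt q} ->
  p * x = u * \prod_(q <- s) q ->
  exists v (r : seq R), [/\ v \is a GRing.unit, {in r, forall q, prime_elt q},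
    size s = (size r).+1 & x = v * \prod_(q <- r) q].
Proof.
move=> hp; have [p0 _ pp] := hp.
elim: s u x => [|q s IH] u x Uu hs e.
  case: (prime_dividesN_unit hp Uu); exists x.
  by rewrite e big_nil mulr1.
have hq : prime_elt q by apply: hs; rewrite mem_head.
have hs' : {in s, forall q, prime_elt q}.
  by move=> r rs; apply: hs; rewrite inE rs orbT.
have e' : p * x = q * (u * \prod_(r <- s) r) by rewrite e big_cons mulrCA.
have [|/(prime_divides_prime hp hq)[w Uw eq]|[y ey]] :=
    pp q (u * \prod_(r <- s) r).
- by exists x.
- exists (w * u), s; split=> //; first by rewrite unitrM Uw.
  by apply: (mulfI p0); rewrite e' eq !mulrA.
have [//|//||v [r [Uv hr sr ey']]] := IH u y; first by rewrite -ey.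
exists v, (q :: r); split=> //; first 1 last.
- by rewrite /= sr.
- by rewrite big_cons mulrCA -ey'; apply: (mulfI p0); rewrite e' ey mulrCA.
by move=> z; rewrite inE => /orP[/eqP -> //|/hr].
Qed.

Lemma factorial_nonunit a : factorial_ring -> a != 0 ->
  a \isn't a GRing.unit -> exists2 p, prime_elt p & divides p a.
Proof.
move=> hR a0 Na; have [u [[|p s] [Uu hs e]]] := hR a a0.
  by move: Na; rewrite e big_nil mulr1 Uu.
exists p; first by apply: hs; rewrite mem_head.
by exists (u * \prod_(q <- s) q); rewrite e big_cons mulrCA.
Qed.

End UniqueFactorization.

Lemma factorial_ring_iso (R S : idomainType) (f : {rmorphism R -> S}) :
  bijective f -> factorial_ring S -> factorial_ring R.
Proof.
move=> [g fK gK] hS a a0.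
have f0 x : (f x == 0) = (x == 0).
  by rewrite -(rmorph0 f) (inj_eq (can_inj fK)).
have gM x y : g (x * y) = g x * g y.
  by apply: (can_inj fK); rewrite rmorphM !gK.
have fU x : (f x \is a GRing.unit) = (x \is a GRing.unit).
  apply/idP/idP => /unitrPr[y e]; apply/unitrPr.
    by exists (g y); apply: (can_inj fK); rewrite rmorphM gK e rmorph1.
  by exists (f y); rewrite -rmorphM e rmorph1.
have [|u [s [Uu hs e]]] := hS (f a); first by rewrite f0.
exists (g u), (map g s); split; first by rewrite -fU gK.
  move=> _ /mapP[p /hs[p0 Np pp] ->]; split; first by rewrite -f0 gK.
    by rewrite -fU gK.
  move=> x y [c ec]; have [|[d ed]|[d ed]] := pp (f x) (f y).
  - by exists (f c); rewrite -rmorphM ec rmorphM gK.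
  - by left; exists (g d); rewrite -gM -ed fK.
  - by right; exists (g d); rewrite -gM -ed fK.
apply: (can_inj fK); rewrite rmorphM gK big_map rmorph_prod e.
by congr (_ * _); apply: eq_bigr => p _; rewrite gK.
Qed.

(** * Gauss's lemma and factoriality of polynomial rings *)

Section Gauss.
Variable R : idomainType.
Implicit Types (p q f g r : {poly R}) (c d : R).

Lemma size_sub_lead p : p != 0 ->
  (size (p - lead_coef p *: 'X^((size p).-1))%R < size p)%N.
Proof.
move=> p0; rewrite -[leqRHS]prednK ?size_poly_gt0 // ltnS.
apply/leq_sizeP => j hj; rewrite coefB coefZ coefXn.
have [->|nj] := eqVneq j (size p).-1; first by rewrite mulr1 subrr.
rewrite mulr0 subr0 nth_default // -[X in (X <= _)%N]prednK ?size_poly_gt0 //.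
by rewrite ltn_neqAle eq_sym nj.
Qed.

Lemma prime_polyC c : prime_elt c -> prime_elt c%:P.
Proof.
move=> [c0 Nc cc]; split; first by rewrite polyC_eq0.
  by rewrite poly_unitE coefC size_polyC c0.
move=> f g.
have [m] := ubnP (size f + size g); elim: m f g => // m IH f g.
rewrite ltnS => hm [h e].
have [->|f0] := eqVneq f 0; first by left; exists 0; rewrite mulr0.
have [->|g0] := eqVneq g 0; first by right; exists 0; rewrite mulr0.
have strip p q : p != 0 -> divides c (lead_coef p) -> divides c%:P (p * q) ->
    exists p', [/\ (size p' < size p)%N, divides c%:P (p' * q) &
      divides c%:P p' -> divides c%:P p].
  move=> p0 [d ed] [k ek]; exists (p - lead_coef p *: 'X^((size p).-1)); split.
  - exact: size_sub_lead.
  - exists (k - d *: 'X^((size p).-1) * q); rewrite mulrBl ek mulrBr.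
    by congr (_ - _); rewrite ed -scalerA -mul_polyC -mulrA.
  - move=> [t et]; exists (t + d *: 'X^((size p).-1)).
    by rewrite mulrDr -et mul_polyC scalerA -ed subrK.
have : divides c (lead_coef f * lead_coef g).
  rewrite -lead_coefM e mul_polyC lead_coefZ; first by exists (lead_coef h).
have D : divides c%:P (f * g) by exists h.
case/cc => [/(strip f g f0) /(_ D)[f' [sf' D' hf']]|/(strip g f g0)].
  have [|//|/hf'|] := IH f' g; [|by left|by right].
  by apply: leq_trans hm; rewrite ltn_add2r.
rewrite mulrC => /(_ D)[g' [sg' D' hg']].
have [||d'|/hg'] := IH f g'; [|by rewrite mulrC|by left|by right].
by apply: leq_trans hm; rewrite ltn_add2l.
Qed.

Hypothesis hR : factorial_ring R.

(** A form of Gauss's lemma: each prime factor of c stays prime in R[X], so it divides q or r and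
    can be cancelled there. *)
Lemma gauss_split c p q r : c != 0 -> c *: p = q * r ->
  exists x y q' r', [/\ q = x *: q', r = y *: r' & p = q' * r'].
Proof.
move=> c0; have [u [s [Uu hs ->]]] := hR c0.
elim: s q r hs => [|d s IH] q r hs.
  rewrite big_nil mulr1 => e; exists u, 1, (u^-1 *: q), r.
  rewrite scale1r scalerA divrr // scale1r -scalerAl -e scalerA mulVr //.
  by rewrite scale1r.
move=> e; have hd : prime_elt d by apply: hs; rewrite mem_head.
have hs' : {in s, forall z, prime_elt z}.
  by move=> z zs; apply: hs; rewrite inE zs orbT.
have [d0 _ dd] := prime_polyC hd.
have [|[t et]|[t et]] := dd q r.
- exists (u * \prod_(j <- s) j *: p).
  by rewrite -e big_cons mulrCA mul_polyC scalerA.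
- have [|x [y [q' [r' [e1 e2 e3]]]]] := IH t r hs'.
    apply: (mulfI d0); rewrite mulrA -et -e big_cons mulrCA.
    by rewrite mul_polyC scalerA.
  by exists (d * x), y, q', r'; split=> //; rewrite et e1 mul_polyC scalerA.
- have [|x [y [q' [r' [e1 e2 e3]]]]] := IH q t hs'.
    apply: (mulfI d0); rewrite mulrCA -et -e big_cons mulrCA.
    by rewrite mul_polyC scalerA.
  by exists x, (d * y), q', r'; split=> //; rewrite et e2 mul_polyC scalerA.
Qed.

Lemma irreducible_divides_scale p c f : irreducible_elt p -> (1 < size p)%N ->
  c != 0 -> divides p (c *: f) -> divides p f.
Proof.
move=> [p0 Np irr] sp c0 [g /(gauss_split c0)[x [y [p' [g' [e1 e2 ->]]]]]].
have [||Up] := irr x%:P p'; first by rewrite mul_polyC.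
  rewrite poly_unitE coefC /= => /andP[_ Ux]; exists (x^-1 *: g').
  by rewrite e1 -scalerAl -scalerAr scalerA mulrC divrr // scale1r.
move: Up sp; rewrite poly_unitE => /andP[/eqP sp' _].
by rewrite e1 ltnNge (leq_trans (size_scale_leq _ _)) // sp'.
Qed.

Lemma irreducible_prime p : irreducible_elt p -> (1 < size p)%N -> prime_elt p.
Proof.
move=> irr sp; have [p0 Np hp] := irr; split=> // f g [m em].
(* A gcd of p and f over the fraction field: it divides p and f, and is a     *)
(* combination of them, up to nonzero constants.                              *)
set r := gcdp p f.
have r0 : r != 0 by rewrite gcdp_eq0 negb_and p0.
have /Pdiv.Idomain.dvdpP[[c q] /= c0 ecq] : r %| p by exact: dvdp_gcdl.
have /Pdiv.Idomain.dvdpP[[d s] /= d0 eds] : r %| f by exact: dvdp_gcdr.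
have [x [y [q' [r' [e1 e2 e3]]]]] := gauss_split c0 ecq.
(* One factor of p = q' r' is a unit. If it is q', then p divides r, hence a nonzero constant
   multiple of f. *)
have [Uq|Ur] := hp _ _ e3.
  left; apply: (irreducible_divides_scale irr sp d0); exists (s * (y *: q'^-1)).
  by rewrite eds e2 e3 -!scalerAr mulrCA mulrAC divrr // mul1r.
(* If r' is a unit, r is constant, and the Bezout identity times g shows that p divides a nonzero
   constant multiple of g. *)
have [[v w] /= /Pdiv.Idomain.eqpP[[a b] /= /andP[a0 b0] e]] :=
  Pdiv.Idomain.Bezoutp p f.
have [z z0 ez] : exists2 z, z != 0 & b *: r = z%:P.
  have sr : (size (b *: r) <= 1)%N.
    rewrite e2 scalerA (leq_trans (size_scale_leq _ _)) //.
    by move: Ur; rewrite poly_unitE => /andP[/eqP ->].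
  exists (b *: r)`_0; last exact: size1_polyC.
  rewrite -polyC_eq0 -size1_polyC // -mul_polyC mulf_neq0 // polyC_eq0.
  exact: b0.
right; apply: (irreducible_divides_scale irr sp z0).
exists (a *: (v * g + w * m)).
rewrite -[z *: g]mul_polyC -ez -e -scalerAl -scalerAr; congr (_ *: _).
by rewrite mulrDl mulrDr -[w * f * g]mulrA em [v * p]mulrC -mulrA [w * _]mulrCA.
Qed.

(** Induction on the size of f, then on the number of primes in its leading coefficient. Splitting
    off a constant prime lowers the second measure. When there is none, a nonconstant f is
    irreducible, hence prime, or a product of two factors of smaller size. *)
Lemma factorial_poly : factorial_ring {poly R}.
Proof.
have const c : c != 0 -> prime_factored c%:P.
  move=> /hR[u [s [Uu hs ->]]]; exists u%:P, (map polyC s); split.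
  - rewrite poly_unitE coefC size_polyC Uu andbT eqb1.
    by apply: contraTneq Uu => ->; rewrite unitr0.
  - by move=> _ /mapP[p /hs hp ->]; apply: prime_polyC.
  - by rewrite big_map polyCM rmorph_prod.
move=> f; have [m] := ubnP (size f); elim: m f => // m IH f.
rewrite ltnS => hm f0; have := hR (_ : lead_coef f != 0).
rewrite lead_coef_eq0 => /(_ f0)[u [s [Uu hs e]]].
have [l] := ubnP (size s).
elim: l s u f {IH}Uu hs e hm f0 (IH) => // l IHl s u f Uu hs e hm f0 IH.
rewrite ltnS => hl.
have [sf|sf] := leqP (size f) 1.
  rewrite (size1_polyC sf) in f0 *; rewrite polyC_eq0 in f0; exact: const.
have [[c hc [g eg]]|Nc] := pselect (exists2 c, prime_elt c & divides c%:P f).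
  have g0 : g != 0 by apply: contraNneq f0 => g0; rewrite eg g0 mulr0.
  rewrite eg; apply: prime_factoredM.
    by apply: prime_factored_prime; exact: prime_polyC.
  have [c0 _ _] := hc.
  have ec : c * lead_coef g = u * \prod_(p <- s) p.
    by rewrite -e eg mul_polyC lead_coefZ.
  have [v [r [Uv hr sr er]]] := prime_factor_cancel hc Uu hs ec.
  apply: (IHl r v g) => //; last by rewrite -ltnS -sr.
  by move: hm; rewrite eg mul_polyC size_scale.
have Nf : f \isn't a GRing.unit by rewrite poly_unitE negb_and gtn_eqF.
have [irr|Nirr] := pselect (irreducible_elt f).
  by apply: prime_factored_prime; exact: irreducible_prime.
have [a [b [ef Na Nb]]] : exists a b, [/\ f = a * b, a \isn't a GRing.unit &
    b \isn't a GRing.unit].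
  apply: contrapT => h; apply: Nirr; split=> // a b ef.
  apply: contrapT => /not_orP[/negP Na /negP Nb]; apply: h.
  by exists a, b.
have [a0 b0] : a != 0 /\ b != 0.
  by apply/andP; rewrite -negb_or -mulf_eq0 -ef.
(* A constant nonunit factor would contain a prime of R dividing f, against [Nc]. *)
have big p q : p != 0 -> f = p * q -> p \isn't a GRing.unit -> (1 < size p)%N.
  move=> p0 ef' Np; rewrite ltnNge; apply/negP => sp.
  rewrite (size1_polyC sp) in p0 ef' Np; rewrite polyC_eq0 in p0.
  have [|d hd [z ez]] := factorial_nonunit hR p0.
    by move: Np; rewrite poly_unitE coefC size_polyC p0.
  by apply: Nc; exists d => //; exists (z%:P * q); rewrite ef' ez polyCM mulrA.
have sa := big _ _ a0 ef Na; rewrite mulrC in ef.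
have sb := big _ _ b0 ef Nb.
move: hm; rewrite ef size_mul // => hm.
by apply: prime_factoredM; apply: IH => //; lia.
Qed.

End Gauss.

(** * Multivariate polynomials as univariate ones *)

Section MpolyUnivariate.
Variable n : nat.
Implicit Type R : comNzRingType.

(** The inverse of [muni], which singles out the last variable; this isomorphism drives the
    inductions on the number of variables. *)
Definition of_univariate R (p : {poly {mpoly R[n]}}) : {mpoly R[n.+1]} :=
  (map_poly (@mwiden n R) p).['X_ord_max].

Lemma muni_mwiden R (p : {mpoly R[n]}) : muni (mwiden p) = p%:P.
Proof.
rewrite [p in LHS]mpolyE [p in RHS]mpolyE (raddf_sum (@mwiden n R)).
rewrite !raddf_sum; apply: eq_bigr => m _.
rewrite /= mwidenZ mwidenX muniZ muniE msuppX big_seq1 mcoeffX eqxx scale1r.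
rewrite mnmwiden_ordmax expr0 -mul_mpolyC -mul_polyC polyCM -mul_polyC mulr1.
by congr (_ * ('X_[_])%:P); apply/mnmP => i; rewrite mnmE mnmwiden_widen.
Qed.

Lemma muni_ord_max R : muni ('X_ord_max : {mpoly R[n.+1]}) = 'X.
Proof.
rewrite muniE msuppX big_seq1 mcoeffX eqxx scale1r mnm1E eqxx expr1.
rewrite (_ : [multinom _ | i < n] = 0%MM) ?mpolyX0 ?scale1r //.
by apply/mnmP => i; rewrite !mnmE -val_eqE /= gtn_eqF.
Qed.

Lemma of_univariateK R : cancel (@of_univariate R) (@muni n R).
Proof.
move=> p; rewrite /of_univariate -[p in RHS]coefK poly_def.
rewrite (@horner_coef_wide _ (size p)) ?size_poly // raddf_sum.
apply: eq_bigr => i _; rewrite coef_map /= muniM rmorphXn /= muni_mwiden.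
by rewrite muni_ord_max mul_polyC.
Qed.

Lemma muniK R : cancel (@muni n R) (@of_univariate R).
Proof.
move=> p; rewrite muniE /of_univariate [p in RHS]mpolyE !raddf_sum horner_sum.
apply: eq_bigr => m _; rewrite /= -mul_polyC rmorphM /=.
rewrite map_polyC map_polyXn hornerM hornerXn hornerC /=.
rewrite mwidenZ mwidenX -scalerAl mpolyXn /= -mpolyXD; congr (_ *: 'X_[_]).
apply/mnmP => i; rewrite mnmDE mulmnE mnm1E.
have [j ->|->] := unliftP ord_max i.
  rewrite (negbTE (neq_lift ord_max j)) mul0n addn0.
  rewrite (_ : lift _ j = widen_ord (leqnSn n) j) ?mnmwiden_widen ?mnmE //.
  by apply: val_inj; rewrite /= /bump leqNgt ltn_ord.
by rewrite eqxx mul1n mnmwiden_ordmax.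
Qed.

Lemma muni_bij R : bijective (@muni n R).
Proof. exists (@of_univariate R); [exact: muniK | exact: of_univariateK]. Qed.

Lemma meval_muni R (p : {mpoly R[n.+1]}) (w : 'I_n.+1 -> R) :
  p.@[w] =
  (map_poly (meval (fun i => w (widen_ord (leqnSn n) i))) (muni p)).[w ord_max].
Proof.
rewrite -[p in LHS]muniK /of_univariate.
rewrite (@horner_coef_wide _ (size (muni p))) ?size_poly //.
rewrite (@horner_coef_wide _ (size (muni p))) ?size_poly // raddf_sum.
apply: eq_bigr => i _; rewrite !coef_map /= mevalM rmorphXn /= mevalXU.
congr (_ * _); rewrite [(muni p)`_i]mpolyE.
rewrite (raddf_sum (@mwiden n R)) !raddf_sum /=; apply: eq_bigr => m _.
rewrite mwidenZ !mevalZ mwidenX !mevalX big_ord_recr /= mnmwiden_ordmax mulr1.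
by congr (_ * _); apply: eq_bigr => j _; rewrite mnmwiden_widen.
Qed.

End MpolyUnivariate.

Lemma factorial_field (k : fieldType) : factorial_ring k.
Proof.
move=> a a0; exists a, [::]; split; rewrite ?big_nil ?mulr1 //.
by rewrite unitfE.
Qed.

Lemma factorial_mpoly (k : fieldType) n : factorial_ring {mpoly k[n]}.
Proof.
elim: n => [|n IH].
  apply: (@factorial_ring_iso _ _ (mcoeff 0%MM)); last exact: factorial_field.
  exists (@mpolyC 0 k); [exact: mpolyKC | exact: mpolyCK].
apply: (@factorial_ring_iso _ _ (@muni n k)); first exact: muni_bij.
exact: factorial_poly.
Qed.

(** A prime factor of F_j fails to divide some F_i, so F_i G_j = F_j G_i forces it to divide G_j.
    Cancel it and continue with the remaining primes of F_j. *)
Lemma coprime_family_divides (R : idomainType) (I : Type) (F G : I -> R) j :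
  factorial_ring R -> (forall p, prime_elt p -> exists i, ~ divides p (F i)) ->
  F j != 0 -> (forall i, F i * G j = F j * G i) -> divides (F j) (G j).
Proof.
move=> hR coF Fj0; have [u [s [Uu hs ->]]] := hR _ Fj0.
move: (G j) => b; elim: s hs b G => [|p s IH] hs b G e.
  by exists (u^-1 * b); rewrite big_nil mulr1 mulVKr.
have hp : prime_elt p by apply: hs; rewrite mem_head.
have [p0 _ pp] := hp; have [i Npi] := coF p hp.
have [||[c ec]] := pp (F i) b; [|by []|].
  by exists (u * \prod_(q <- s) q * G i); rewrite e big_cons mulrCA !mulrA.
have [||d ed] := IH _ c G; first by move=> q qs; apply: hs; rewrite inE qs orbT.
  move=> l; apply: (mulfI p0); rewrite mulrCA -ec e big_cons.
  by rewrite !mulrA [p * u]mulrC.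
by exists d; rewrite ec ed big_cons [u * (p * _)]mulrCA !mulrA.
Qed.

(** Choose the first coordinates off the zeros of the leading coefficient in the last variable, then
    the last coordinate off the roots of the resulting univariate polynomial. *)
Lemma mpoly_nonroot (k : closedFieldType) n (p : {mpoly k[n]}) : p != 0 ->
  exists v : 'rV[k]_n, p.@[v ord0] != 0.
Proof.
elim: n p => [|n IH] p p0.
  by exists 0; move: p0; rewrite [p]nvar0_mpolyC mevalC mpolyC_eq0.
have q0 : muni p != 0 by rewrite -(muni0 n k) (inj_eq (bij_inj (muni_bij n k))).
have [v hv] : exists v : 'rV_n, (lead_coef (muni p)).@[v ord0] != 0.
  by apply: IH; rewrite lead_coef_eq0.
pose q := map_poly (meval (v ord0)) (muni p).
have /closed_nonrootP[x hx] : q != 0.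
  by apply: contraNneq hv => q0'; have := congr1 (coefp (size (muni p)).-1) q0';
    rewrite /= coef_map coef0 => /eqP.
exists (\row_i if unlift ord_max i is Some j then v ord0 j else x).
rewrite meval_muni mxE unlift_none; move: hx; rewrite /root.
congr (_ != _); congr (_.[_]); apply: eq_map_poly => r; apply: meval_eq => i.
rewrite mxE (_ : widen_ord _ i = lift ord_max i) ?liftK //.
by apply: val_inj; rewrite /= /bump leqNgt ltn_ord.
Qed.

(** * Hilbert's basis theorem *)

Section Noetherian.
Implicit Type R : comNzRingType.

Definition initial_ideal R (a : nat -> R) (N : nat) : set R :=
  [set y | exists c : nat -> R, y = \sum_(i < N) c i * a i].

(* The ascending chain condition for the ideals (a 0, ..., a (N - 1)). *)
Definition noetherian R :=
  forall a : nat -> R, exists N, initial_ideal a N (a N).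

Lemma initial_ideal0 R (a : nat -> R) N : initial_ideal a N 0.
Proof. by exists (fun=> 0); rewrite big1 // => i _; rewrite mul0r. Qed.

Lemma initial_idealMD R (a : nat -> R) N c y z : initial_ideal a N y ->
  initial_ideal a N z -> initial_ideal a N (c * y + z).
Proof.
move=> [d ->] [e ->]; exists (fun i => c * d i + e i).
rewrite mulr_sumr -big_split; apply: eq_bigr => i _ /=.
by rewrite mulrDl mulrA.
Qed.

Lemma initial_ideal_sum R (a : nat -> R) N M (c z : nat -> R) :
  (forall i, (i < M)%N -> initial_ideal a N (z i)) ->
  initial_ideal a N (\sum_(i < M) c i * z i).
Proof.
elim: M => [|M IH] hz; first by rewrite big_ord0; exact: initial_ideal0.
rewrite big_ord_recr /= addrC; apply: initial_idealMD; first exact: hz.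
by apply: IH => i hi; apply: hz; rewrite ltnS ltnW.
Qed.

Lemma initial_ideal_gen R (a : nat -> R) N i :
  (i < N)%N -> initial_ideal a N (a i).
Proof.
move=> hi; exists (fun j => (j == i)%:R).
rewrite (bigD1 (Ordinal hi)) //= eqxx mul1r big1 ?addr0 // => j.
by rewrite -val_eqE /= => /negPf ->; rewrite mul0r.
Qed.

Lemma initial_ideal_le R (a : nat -> R) N M : (N <= M)%N ->
  initial_ideal a N `<=` initial_ideal a M.
Proof.
move=> NM y [c ->]; apply: initial_ideal_sum => i hi.
by apply: initial_ideal_gen; exact: leq_trans NM.
Qed.

Lemma noetherian_iso R (S : comNzRingType) (f : {rmorphism R -> S}) :
  bijective f -> noetherian S -> noetherian R.
Proof.
move=> [g fK gK] hS a; have [N [c e]] := hS (f \o a); exists N, (g \o c).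
apply: (can_inj fK); rewrite [LHS]e rmorph_sum; apply: eq_bigr => i _.
by rewrite rmorphM /= gK.
Qed.

Lemma noetherian_field (k : fieldType) : noetherian k.
Proof.
move=> a; have [a0|a0] := eqVneq (a 0%N) 0.
  by exists 0%N; rewrite a0; exact: initial_ideal0.
by exists 1%N, (fun=> a 1%N / a 0%N); rewrite big_ord1 divfK.
Qed.

(** If no f N lies in the ideal of its predecessors, no finite list in the ideal I of all f N
    generates I. Picking g N of least size in I outside the ideal of the previous ones, a relation
    among leading coefficients cancels the top term of some g N and contradicts minimality. *)
Lemma noetherian_poly R : noetherian R -> noetherian {poly R}.
Proof.
move=> hR f; apply: contrapT => /forallNP nof.
pose I : set {poly R} := [set y | exists N, initial_ideal f N y].
pose J (s : seq {poly R}) := initial_ideal (nth 0 s) (size s).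
have I_le y : I y -> exists N, forall M, (N <= M)%N -> initial_ideal f M y.
  by move=> [N hN]; exists N => M NM; apply: initial_ideal_le hN.
have bound (s : seq {poly R}) : {in s, forall y, I y} ->
    exists N, forall M, (N <= M)%N -> {in s, forall y, initial_ideal f M y}.
  elim: s => [|y s IH] hs; first by exists 0%N.
  have [|N hN] := IH; first by move=> z zs; apply: hs; rewrite inE zs orbT.
  have [|N' hN'] := I_le y; first by apply: hs; rewrite mem_head.
  exists (maxn N N') => M; rewrite geq_max => /andP[h h'] z.
  by rewrite inE => /orP[/eqP ->|]; [exact: hN'|exact: hN].
have ex (s : seq {poly R}) : {in s, forall y, I y} ->
    exists y, [/\ I y, ~ J s y &
    forall z, I z -> ~ J s z -> (size y <= size z)%N].
  move=> hs; have [N hN] := bound s hs.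
  have : exists m, `[< exists y, [/\ I y, ~ J s y & size y = m] >].
    exists (size (f N)); apply/asboolP; exists (f N); split=> //.
      by exists N.+1; exact: initial_ideal_gen.
    move=> [c e]; apply: (nof N); rewrite e; apply: initial_ideal_sum => i hi.
    by apply: hN => //; exact: mem_nth.
  move=> h; case: (ex_minnP h) => m /asboolP[y [Iy Ny <-]] hm.
  exists y; split=> //.
  by move=> z Iz Nz; apply: hm; apply/asboolP; exists z.
have /choice[sel hsel] (s : seq {poly R}) : exists y,
    {in s, forall y, I y} -> [/\ I y, ~ J s y &
    forall z, I z -> ~ J s z -> (size y <= size z)%N].
  have [/ex[y hy]|h] := pselect {in s, forall y, I y}; first by exists y.
  by exists 0.
(* g N is an element of least degree of I outside (g 0, ..., g (N - 1)).      *)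
pose hist N := iter N (fun s => rcons s (sel s)) [::].
pose g N := sel (hist N).
have hist_mk N : hist N = mkseq g N.
  by elim: N => // N IH; rewrite mkseqS -IH.
have J_hist N : J (hist N) = initial_ideal g N.
  rewrite /J hist_mk size_mkseq; apply/seteqP; split => y [c ->]; exists c;
  by apply: eq_bigr => i _; rewrite nth_mkseq.
have hist_I N : {in hist N, forall y, I y}.
  elim: N => // N IH y; rewrite /= mem_rcons inE => /orP[/eqP ->|/IH //].
  by case: (hsel _ IH).
have gP N : [/\ I (g N), ~ initial_ideal g N (g N) &
    forall z, I z -> ~ initial_ideal g N z -> (size (g N) <= size z)%N].
  by rewrite -J_hist; exact: hsel.
have [N [c ec]] := hR (lead_coef \o g).
have [IN NN minN] := gP N.
(* For i < N, g i is at most as large as g N, so a power of X brings it to the size of g N and keeps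
   its leading coefficient. *)
pose z i := 'X^(size (g N) - size (g i)) * g i.
pose y := g N - \sum_(i < N) (c i)%:P * z i.
have gi i : (i < N)%N -> g i != 0 /\ (size (g i) <= size (g N))%N.
  move=> hi; have [_ Ni mini] := gP i; split.
    by apply/eqP => g0; apply: Ni; rewrite g0; exact: initial_ideal0.
  by apply: mini => // h; apply: NN; apply: initial_ideal_le h; exact: ltnW.
have g0 : g N != 0.
  by apply/eqP => g0; apply: NN; rewrite g0; exact: initial_ideal0.
have zi i : (i < N)%N -> size (z i) = size (g N) /\
    (z i)`_((size (g N)).-1) = lead_coef (g i).
  move=> /gi[gi0 hi]; rewrite /z size_monicM ?monicXn // size_polyXn.
  move: hi; rewrite -!size_poly_gt0 in gi0 g0 * => hi.
  split; first by rewrite addSn /= subnK.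
  rewrite coefXnM ifF; last by apply/negbTE; lia.
  by congr (_`_ _); lia.
have sumP (K : set {poly R}) (a : nat -> {poly R}) M : K = initial_ideal a M ->
    (forall i, (i < N)%N -> K (g i)) -> K (\sum_(i < N) (c i)%:P * z i).
  move=> -> hK; under eq_bigr do rewrite /z mulrA.
  exact: (initial_ideal_sum
    (fun i => (c i)%:P * 'X^(size (g N) - size (g i)))%R).
have Iy : I y.
  have [M hM] := bound (hist N.+1) (hist_I N.+1); exists M.
  have gM i : (i <= N)%N -> initial_ideal f M (g i).
    move=> hi; apply: hM => //; rewrite hist_mk.
    by apply: map_f; rewrite mem_iota.
  rewrite /y addrC -mulN1r; apply: initial_idealMD; last exact: gM.
  by apply: (sumP _ f M) => // i /ltnW; exact: gM.
have Ny : ~ initial_ideal g N y.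
  move=> hy; apply: NN; rewrite -[g N](subrK (\sum_(i < N) (c i)%:P * z i)).
  rewrite -[g N - _]mul1r; apply: initial_idealMD => //.
  by apply: (sumP _ g N) => // i; exact: initial_ideal_gen.
have := minN _ Iy Ny; rewrite leqNgt => /negP; apply.
rewrite -[ltnRHS]prednK ?size_poly_gt0 // ltnS; apply/leq_sizeP => j hj.
rewrite coefB coef_sum; have [->|nj] := eqVneq j (size (g N)).-1.
  rewrite [X in X - _]ec; apply/eqP; rewrite subr_eq0; apply/eqP.
  by apply: eq_bigr => i _; rewrite coefCM (zi i _).2.
have hj' : (size (g N) <= j)%N by move: g0; rewrite -size_poly_gt0; lia.
rewrite nth_default // big1 ?subrr // => i _.
by rewrite coefCM nth_default ?mulr0 // (zi i _).1.
Qed.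

Lemma noetherian_mpoly (k : fieldType) n : noetherian {mpoly k[n]}.
Proof.
elim: n => [|n IH].
  apply: (@noetherian_iso _ _ (mcoeff 0%MM)); last exact: noetherian_field.
  by exists (@mpolyC 0 k); [exact: mpolyKC | exact: mpolyCK].
apply: (@noetherian_iso _ _ (@muni n k)); first exact: muni_bij.
exact: noetherian_poly.
Qed.

End Noetherian.

(** * Families of polynomials *)

(** A homogeneous linear system has a nonzero solution iff its rank is below the number of unknowns,
    that is, iff all minors of that size vanish. *)
Lemma alg_set_kernel (k : closedFieldType) m (A B : finType)
    (M : A -> B -> {mpoly k[m]}) :
  alg_set [set t : 'rV[k]_m | exists2 c : A -> k, exists a, c a != 0 &
    forall b, \sum_a c a * (M a b).@[t ord0] = 0].
Proof.
pose Q : 'M[{mpoly k[m]}]_(#|B|, #|A|) :=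
  \matrix_(b, a) M (enum_val a) (enum_val b).
pose ev (t : 'rV[k]_m) : {rmorphism {mpoly k[m]} -> k} := meval (t ord0).
have sumE (t : 'rV[k]_m) (c : 'rV[k]_#|A|) b :
    (c *m (map_mx (ev t) Q)^T) ord0 b =
    \sum_a c ord0 (enum_rank a) * (M a (enum_val b)).@[t ord0].
  rewrite mxE (reindex_onto _ _ (fun a _ => enum_valK a)) /=.
  apply: eq_big => [a|a _]; first by rewrite enum_rankK eqxx.
  by rewrite !mxE enum_rankK.
(* A map f that repeats a row gives a zero minor, so systems with fewer equations than unknowns are
   covered. *)
exists [set p | exists f : 'I_#|A| -> 'I_#|B|, p = \det (rowsub f Q)].
apply/seteqP; split => [t [c [a ca0] hc] _ [f ->]|t ht] /=.
  have -> : (\det (rowsub f Q)).@[t ord0] = \det (rowsub f (map_mx (ev t) Q)).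
    by rewrite -map_mxsub det_map_mx.
  rewrite -det_tr; apply/eqP/det0P; exists (\row_i c (enum_val i)).
    by apply: contraNneq ca0 => /rowP/(_ (enum_rank a));
      rewrite !mxE enum_rankK => ->.
  apply/rowP => i.
  transitivity ((\row_i c (enum_val i) *m (map_mx (ev t) Q)^T) ord0 (f i)).
    by rewrite !mxE; apply: eq_bigr => j _; rewrite !mxE.
  rewrite sumE mxE -[RHS](hc (enum_val (f i))); apply: eq_bigr => b _.
  by rewrite mxE enum_rankK.
have : ~~ row_full (map_mx (ev t) Q).
  apply/negP => full; have := fullrowsub_unit full.
  rewrite unitmxE unitfE -map_mxsub det_map_mx => /negP; apply; apply/eqP.
  by apply: ht; exists (fullrankfun full).
rewrite /row_full -mxrank_tr -/(row_free _) -kermx_eq0.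
case/rowV0Pn => v /sub_kermxP hv v0.
exists (fun a => v ord0 (enum_rank a)).
  apply: contrapT => h; case/eqP: v0; apply/rowP => i; rewrite mxE.
  apply: contrapT => /eqP hi; apply: h; exists (enum_val i).
  by rewrite enum_valK.
by move=> b; have := sumE t v (enum_rank b); rewrite enum_rankK hv mxE => <-.
Qed.

Section Families.
Variables (k : closedFieldType) (m n : nat).

Definition family := {mpoly {mpoly k[m]}[n]}.

Definition spec (t : 'rV[k]_m) : {rmorphism family -> {mpoly k[n]}} :=
  map_mpoly (meval (t ord0)).

Lemma mcoeff_spec t (P : family) mu : (spec t P)@_mu = (P@_mu).@[t ord0].
Proof. exact: mcoeff_map_mpoly. Qed.

Lemma spec_homog t (P : family) d : P \is d.-homog -> spec t P \is d.-homog.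
Proof.
move=> hP; apply/dhomogP => mu; rewrite mcoeff_msupp mcoeff_spec => h.
apply: (dhomog_mf hP); rewrite mcoeff_msupp.
by apply: contraNneq h => ->; rewrite meval0.
Qed.

Lemma spec_mpolyX t mu : spec t 'X_[mu] = 'X_[mu].
Proof. exact: map_mpolyX. Qed.

(** The unknowns are the finitely many coefficients of the G i; comparing coefficients of the
    products gives a linear system for [alg_set_kernel]. *)
Lemma alg_set_proportional (I : finType) (F : I -> family) d :
  alg_set [set t : 'rV[k]_m | exists G : I -> {mpoly k[n]},
    [/\ forall i, G i \is d.-homog, exists i, G i != 0 &
        forall i j, spec t (F i) * G j = spec t (F j) * G i]].
Proof.
(* Only monomials of degree below D occur in the products, so finitely many equations suffice. *)
pose D := (\max_i msize (F i) + d.+2).+1%N.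
pose mon := {mu : 'X_{1..n < d.+1} | mdeg mu == d}.
pose E (R : nzRingType) (a : I * mon) j : {mpoly R[n]} :=
  if a.1 == j then 'X_[val (val a.2)] else 0.
pose M a (b : (I * I) * 'X_{1..n}) : {mpoly k[m]} :=
  (F b.1.1 * E _ a b.1.2 - F b.1.2 * E _ a b.1.1)@_b.2.
pose GG (c : I * mon -> k) j : {mpoly k[n]} := \sum_a c a *: E k a j.
have GGE (c : I * mon -> k) (t : 'rV[k]_m) b :
    \sum_a c a * (M a b).@[t ord0] =
    (spec t (F b.1.1) * GG c b.1.2 - spec t (F b.1.2) * GG c b.1.1)@_b.2.
  have sE a j : spec t (E _ a j) = E _ a j.
    by rewrite /E; case: eqP => _; [exact: spec_mpolyX|exact: rmorph0].
  rewrite !mulr_sumr -sumrB raddf_sum; apply: eq_bigr => a _ /=.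
  rewrite -mcoeff_spec rmorphB !rmorphM !sE /=.
  by rewrite -!scalerAr -scalerBr mcoeffZ.
have MD a b : (D <= mdeg b.2)%N -> M a b = 0.
  move=> hb; have z i j : (F i * E _ a j)@_b.2 = 0.
    apply/memN_msupp_eq0/msize_mdeg_ge/(leq_trans _ hb).
    apply: leq_trans (msizeM_le _ _) _; rewrite ltnS; apply: leq_add.
      exact: (leq_bigmax_cond (F := fun i => msize (F i))).
    rewrite /E; case: eqP => _; last by rewrite msize0.
    by rewrite msizeX (eqP (valP a.2)).
  by rewrite /M mcoeffB !z subrr.
have GG_homog c j : GG c j \is d.-homog.
  apply: rpred_sum => a _; apply: rpredZ; rewrite /E.
  case: eqP => _; last exact: rpred0.
  by rewrite dhomogX; exact: (valP a.2).
have GG_coef c (a : I * mon) : (GG c a.1)@_(val (val a.2)) = c a.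
  rewrite raddf_sum (bigD1 a) //= /E eqxx mcoeffZ mcoeffX eqxx mulr1.
  rewrite big1 ?addr0 // => b ba; rewrite mcoeffZ.
  case: eqP => [e|_]; last by rewrite mcoeff0 mulr0.
  rewrite mcoeffX; case: eqP => [e'|_]; last by rewrite mulr0.
  case/eqP: ba; move: a b e e' => [i mu] [j nu] /= -> e'.
  by congr pair; apply: val_inj; apply: val_inj.
have GG_all (G : I -> {mpoly k[n]}) : (forall i, G i \is d.-homog) ->
    G = GG (fun a => (G a.1)@_(val (val a.2))).
  move=> hG; apply/funext => i; apply/mpolyP => nu.
  have [hnu|hnu] := eqVneq (mdeg nu) d; last first.
    by rewrite !(dhomog_nemf_coeff _ hnu).
  have lnu : (mdeg nu < d.+1)%N by rewrite hnu.
  pose mu : mon := exist (fun mu : 'X_{1..n < d.+1} => mdeg mu == d)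
    (BMultinom lnu) (introT eqP hnu).
  by rewrite -[nu]/(val (val (i, mu).2)) -[i in RHS]/((i, mu).1) GG_coef.
have := alg_set_kernel
  (fun a (b : (I * I) * 'X_{1..n < D}) => M a (b.1, val b.2)).
congr alg_set; apply/seteqP; split => t.
  move=> [c [a ca] hc]; exists (GG c); split=> //.
    exists a.1; apply: contraNneq ca => G0; rewrite -GG_coef G0.
    by rewrite mcoeff0.
  move=> i j; apply/eqP; rewrite -subr_eq0; apply/eqP/mpolyP => nu.
  rewrite mcoeff0 -(GGE c t ((i, j), nu)).
  have [hnu|hnu] := leqP D (mdeg nu).
    by rewrite big1 // => b _; rewrite MD ?meval0 ?mulr0.
  exact: (hc ((i, j), BMultinom hnu)).
move=> [G [hG [i Gi] hFG]]; exists (fun a => (G a.1)@_(val (val a.2))).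
  apply: contrapT => h; case/eqP: Gi; rewrite (GG_all G hG) /GG big1 // => a _.
  rewrite [X in X *: _](_ : _ = 0) ?scale0r //.
  by apply: contrapT => /eqP h'; apply: h; exists a.
move=> b; rewrite GGE -(GG_all G hG) /= hFG subrr; exact: mcoeff0.
Qed.

End Families.

Arguments spec {k m n} t.

(** * Zariski topology and lines *)

Section Topology.
Variables (k : closedFieldType) (T : atlas k).
Implicit Types U V W : set T.

Lemma zopenT : zopen [set: T].
Proof.
move=> i; exists set0; last by move=> x _; split=> // /(_ Logic.I).
exists [set 1]; apply/esym; rewrite -subset0 => x /(_ 1 erefl) /eqP.
by rewrite meval1 oner_eq0.
Qed.

Lemma zclosedI U V : zclosed U -> zclosed V -> zclosed (U `&` V).
Proof.
move=> hU hV i; have [C hC eC] := hU i; have [D hD eD] := hV i.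
exists (C `&` D); first exact: alg_setI.
by move=> x hx; split=> -[/(eC x hx) ? /(eD x hx) ?].
Qed.

Lemma zopenI U V : zopen U -> zopen V -> zopen (U `&` V).
Proof.
rewrite /zopen setCI => hU hV i; have [C hC eC] := hU i; have [D hD eD] := hV i.
exists (C `|` D); first exact: alg_setU.
by move=> x hx; split=> -[/(eC x hx)|/(eD x hx)]; [left|right|left|right].
Qed.

Lemma zdenseI U V : zopen V -> zdense U -> zdense V -> zdense (U `&` V).
Proof.
move=> oV dU dV W oW W0.
by have [x [[Wx Vx] Ux]] := dU _ (zopenI oW oV) (dV _ oW W0); exists x.
Qed.

Lemma zopen_principal W i x : zopen W -> W x -> cdom T i x ->
  exists2 h : {mpoly k[dim i]}, h.@[chart T i x ord0] != 0 &
    forall y, cdom T i y -> h.@[chart T i y ord0] != 0 -> W y.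
Proof.
move=> /(_ i)[_ [S ->] hS] Wx hx.
have : ~ (forall h, S h -> h.@[chart T i x ord0] = 0) by move=> /(hS x hx).
move=> /existsNP[h /not_implyP[Sh /eqP hhx]]; exists h => // y hy hhy.
apply: contrapT => NWy; case/eqP: hhy.
by have /hS := NWy; apply.
Qed.

(** C consists of the common zeros of all polynomials vanishing on F in the chart. If p is an
    equation of the local closed set at x, then g p vanishes on F; so at a point x of C it vanishes
    too, and g is nonzero there. *)
Lemma zclosed_local F i : (forall x, cdom T i x ->
    exists (g : {mpoly k[dim i]}) (C : set 'rV_(dim i)),
    [/\ g.@[chart T i x ord0] != 0, alg_set C & forall y, cdom T i y ->
        g.@[chart T i y ord0] != 0 -> (F y <-> C (chart T i y))]) ->
  exists2 C : set 'rV_(dim i), alg_set C &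
    forall x, cdom T i x -> (F x <-> C (chart T i x)).
Proof.
move=> loc; pose S : set {mpoly k[dim i]} := [set h | forall x, cdom T i x ->
  F x -> h.@[chart T i x ord0] = 0].
exists [set u | forall h, S h -> h.@[u ord0] = 0]; first by exists S.
move=> x hx; split=> [Fx h|hSx]; first exact.
have [g [_ [gx [S' ->] hF]]] := loc x hx; apply/hF => // p S'p.
have /eqP : (g * p).@[chart T i x ord0] = 0.
  apply: hSx => y hy Fy; rewrite mevalM.
  have [->|gy] := eqVneq (g.@[chart T i y ord0]) 0; first by rewrite mul0r.
  by have /(_ p S'p) -> := (hF y hy gy).1 Fy; rewrite mulr0.
by rewrite mevalM mulf_eq0 (negPf gx) /= => /eqP.
Qed.

Lemma regular_map_subset (Y : atlas k) U V (f : T -> Y) :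
  zopen V -> V `<=` U -> regular_map U f -> regular_map V f.
Proof.
move=> oV VU hf j; have [oU rf] := hf j; split.
  rewrite (_ : V `&` f @^-1` cdom Y j = V `&` (U `&` f @^-1` cdom Y j)).
    exact: zopenI.
  apply/seteqP; split=> x [Vx]; last by case.
  by move=> fx; split=> //; split=> //; exact: VU.
move=> l i x [Vx fx] hx.
have [|p [q [q0 pq]]] := rf l i x _ hx; first by split=> //; exact: VU.
by exists p, q; split=> // y [Vy fy]; apply: pq; split=> //; exact: VU.
Qed.

Lemma bir_class_subset (f : Bir T) U V g : bir_class f (U, g) ->
  zopen V -> zdense V -> V `<=` U -> bir_class f (V, g).
Proof.
have [p hp ->] := bir_classP f.
move=> [[oU dU rg] [W [oW dW WU e]]] oV dV VU; split.
  by split=> //; exact: regular_map_subset rg.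
exists (W `&` V); split.
- exact: zopenI.
- exact: zdenseI.
- by move=> x [Wx Vx]; have [] := WU _ Wx.
- by move=> x [/e].
Qed.

Lemma bir_class_agree (f : Bir T) U V g h :
  bir_class f (U, g) -> bir_class f (V, h) ->
  exists W, [/\ zopen W, zdense W & forall x, W x -> g x = h x].
Proof.
have [p hp ->] := bir_classP f.
move=> [_ [W [oW dW _ e]]] [_ [W' [oW' dW' _ e']]].
exists (W `&` W'); split; [exact: zopenI|exact: zdenseI|].
by move=> x [/e /= <- /e' /= <-].
Qed.

Lemma bir_class_open (f : Bir T) U g :
  bir_class f (U, g) -> zopen U /\ zdense U.
Proof. by have [p hp ->] := bir_classP f => -[[]]. Qed.

End Topology.

(** * Lines and homogeneous coordinates *)

Section Lines.
Variables (k : closedFieldType) (n : nat).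
Implicit Types (L : line k n) (v w : 'rV[k]_n.+1).

Lemma vector_coord_neq0 v : v != 0 -> exists j, v ord0 j != 0.
Proof.
move=> v0; apply: contrapT => h; case/eqP: v0; apply/rowP => i; rewrite mxE.
by apply: contrapT => /eqP vi; apply: h; exists i.
Qed.

Lemma mem_lineP L v : v != 0 ->
  v \in sval L <-> exists2 c, c != 0 & vpick (sval L) = c *: v.
Proof.
move=> v0; have [/= eL r0] := line_rep L; split=> [vL|].
  have /vlineP[c e] : v \in <[vpick (sval L)]>%VS by rewrite -eL.
  have c0 : c != 0.
    by apply: contraNneq v0 => c0; rewrite e c0 scale0r.
  by exists c^-1; rewrite ?invr_eq0 // e scalerA mulVf // scale1r.
move=> [c c0 e]; rewrite -[v](scalerK c0) -e memvZ //; exact: memv_pick.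
Qed.

Lemma line_through v : v != 0 -> exists L, v \in sval L.
Proof.
by move=> v0; have [L hL] := line_of v0; exists L; apply/mem_lineP.
Qed.

Lemma mem_line_minors L v w : v \in sval L -> w \in sval L ->
  forall i j, v ord0 i * w ord0 j = v ord0 j * w ord0 i.
Proof.
have [-> _] := line_rep L.
move=> /vlineP[c ->] /vlineP[d ->] i j; rewrite !mxE.
by rewrite mulrACA [RHS]mulrACA [X in _ * X]mulrC.
Qed.

Lemma minors_mem_line L v w : v != 0 -> v \in sval L ->
  (forall i j, v ord0 i * w ord0 j = v ord0 j * w ord0 i) -> w \in sval L.
Proof.
move=> v0 vL e; have [i vi] := vector_coord_neq0 v0.
suff -> : w = (w ord0 i / v ord0 i) *: v by exact: memvZ.
apply/rowP => j; rewrite mxE; apply: (mulfI vi).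
by rewrite e mulrA [_ * (_ / _)]mulrC divfK // mulrC.
Qed.

Definition affine_part (j : 'I_n.+1) v : 'rV[k]_n :=
  \row_l (v ord0 (lift j l) / v ord0 j).

(** Charts can be computed from any nonzero vector of the line instead of the one selected by
    [vpick]. *)
Lemma chart_mem_line L v j : v != 0 -> v \in sval L ->
  (cdom (proj k n) j L <-> v ord0 j != 0) /\
  chart (proj k n) j L = affine_part j v.
Proof.
move=> v0 /(mem_lineP _ v0)[c c0 e]; split.
  by rewrite /= e mxE mulf_eq0 (negPf c0).
by apply/rowP => l; rewrite !mxE e !mxE -mulf_div divff // mul1r.
Qed.

Lemma meval_homog (R : comNzRingType) (p : {mpoly R[n]}) d c (v : 'I_n -> R) :
  p \is d.-homog -> p.@[fun i => c * v i] = c ^+ d * p.@[v].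
Proof.
move=> hp; rewrite !mevalE mulr_sumr; apply: eq_big_seq => mu hmu.
under eq_bigr do rewrite exprMn.
by rewrite big_split /= prodrXr -mdegE (dhomog_mf hp hmu) mulrCA.
Qed.

End Lines.

(** * Homogenization with parameters *)

Section Homogenization.
Variables (k : closedFieldType) (m n : nat).

(** H(t, x) is x_j^D h(t, x/x_j): each monomial receives the power of x_j that its x-degree lacks to
    reach D. *)
Lemma homogenization (h : {mpoly k[m + n]}) (j : 'I_n.+1) D :
  (msize h <= D)%N -> exists2 H : family k m n.+1, H \is D.-homog &
    forall (t : 'rV[k]_m) (v : 'rV[k]_n.+1), v ord0 j != 0 ->
      (spec t H).@[v ord0] =
      v ord0 j ^+ D * h.@[row_mx t (affine_part j v) ord0].
Proof.
move=> hD; pose r (mu : 'X_{1..m + n}) := (\sum_(l < n) mu (rshift m l))%N.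
pose par (mu : 'X_{1..m + n}) : 'X_{1..m} := [multinom mu (lshift n l) | l < m].
pose hom (mu : 'X_{1..m + n}) : 'X_{1..n.+1} :=
  [multinom if unlift j a is Some l then mu (rshift m l) else (D - r mu)%N
  | a < n.+1].
have rD mu : mu \in msupp h -> (r mu <= D)%N.
  move=> hmu; have : (mdeg mu <= D)%N.
    by apply: ltnW; apply: leq_trans hD; exact: msize_mdeg_lt.
  by apply: leq_trans; rewrite mdegE big_split_ord /= leq_addl.
exists (\sum_(mu <- msupp h) (h@_mu *: 'X_[par mu]) *: 'X_[hom mu]).
  rewrite big_seq; apply: rpred_sum => mu /rD hmu; apply: rpredZ.
  rewrite dhomogX; apply/eqP; rewrite -[LHS]/(mdeg (hom mu)) mdegE.
  rewrite (bigD1_ord j) //= mnmE unlift_none.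
  under eq_bigr do rewrite mnmE liftK.
  by rewrite subnK.
move=> t v vj; rewrite (raddf_sum (spec t)) (raddf_sum (meval (v ord0))).
rewrite mevalE mulr_sumr.
apply: eq_big_seq => mu /rD hmu.
rewrite /= map_mpolyZ map_mpolyX mevalZ /= mevalZ !mevalX.
rewrite [RHS]mulrCA -mulrA; congr (_ * _).
rewrite big_split_ord /= [RHS]mulrCA; congr (_ * _).
  by apply: eq_bigr => l _; rewrite mnmE row_mxEl.
rewrite (bigD1_ord j) //= mnmE unlift_none.
under eq_bigr do rewrite mnmE liftK.
under [in RHS]eq_bigr do rewrite row_mxEr mxE expr_div_n.
rewrite prodf_div prodrXr -/(r mu) -[in RHS](subnK hmu) exprD.
by rewrite -mulrA [_ ^+ r mu * _]mulrCA divff ?mulr1 // expf_neq0.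
Qed.

End Homogenization.

(** * Open subsets of projective space *)

Section ProjectiveOpens.
Variables (k : closedFieldType) (n : nat).
Implicit Types (L : proj k n) (v : 'rV[k]_n.+1) (H : {mpoly k[n.+1]}).

Lemma vpick_line_neq0 L : vpick (sval L) != 0.
Proof. by have [] := line_rep L. Qed.

Lemma meval_homog_scale H d c v :
  H \is d.-homog -> H.@[(c *: v) ord0] = c ^+ d * H.@[v ord0].
Proof.
by move=> hH; rewrite -(meval_homog _ _ hH); apply: meval_eq => i; rewrite mxE.
Qed.

(** Homogenize, without parameters, the equation of a principal neighbourhood in chart j. The extra
    factor x_j makes the form vanish outside that chart. *)
Lemma proj_open_form (W : set (proj k n)) L0 : zopen W -> W L0 ->
  exists (H : {mpoly k[n.+1]}) d, [/\ H \is d.-homog,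
    H.@[vpick (sval L0) ord0] != 0 &
    forall v L, v != 0 -> v \in sval L -> H.@[v ord0] != 0 -> W L].
Proof.
move=> oW WL0; have v0 := vpick_line_neq0 L0; set v := vpick _ in v0 *.
have [j vj] := vector_coord_neq0 v0.
have chartE w L := @chart_mem_line k n L w j.
have [h hh hW] := zopen_principal oW WL0 (vj : cdom (proj k n) j L0).
have [H hH HE] := @homogenization k 0 n h j _ (leqnn _).
have row0 (u : 'rV[k]_n) : h.@[row_mx (0 : 'rV_0) u ord0] = h.@[u ord0].
  apply: meval_eq => i; rewrite mxE; case: splitP => [[]//|l e].
  by congr (u _ _); apply: val_inj.
exists (spec 0 H * 'X_j), (msize h + 1)%N; split.
- by apply: dhomogM; [exact: spec_homog | rewrite dhomogX; apply/eqP/mdeg1].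
- rewrite mevalM mevalXU HE // row0 -(chartE v L0 v0 (memv_pick _)).2.
  by rewrite !mulf_neq0 ?expf_neq0.
- move=> w L w0 wL; rewrite mevalM mevalXU mulf_eq0 negb_or => /andP[Hw wj].
  have [dL cL] := chartE w L w0 wL.
  apply: (hW L (dL.2 wj)); rewrite cL -row0.
  by move: Hw; rewrite HE // mulf_eq0 negb_or => /andP[].
Qed.

Lemma homog_zopen H d : H \is d.-homog ->
  zopen [set L : proj k n | H.@[vpick (sval L) ord0] != 0].
Proof.
move=> hH j.
pose hom (u : 'rV[k]_n) : 'rV[k]_n.+1 :=
  \row_a if unlift j a is Some l then u ord0 l else 1.
exists (hom @^-1` [set w | H.@[w ord0] = 0]).
  apply: alg_set_preimage; last exact: alg_set1.
  move=> a; exists (if unlift j a is Some l then 'X_l else 1) => u.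
  by rewrite mxE; case: unlift => [l|]; rewrite ?mevalXU ?meval1.
move=> L hL; have vj : vpick (sval L) ord0 j != 0 by exact: hL.
have e : vpick (sval L) =
    vpick (sval L) ord0 j *: hom (chart (proj k n) j L).
  apply/rowP => a; rewrite !mxE.
  case: unliftP => [l|] ->; last by rewrite mulr1.
  by rewrite mxE mulrC divfK.
have {e}eH : H.@[vpick (sval L) ord0] = vpick (sval L) ord0 j ^+ d *
    H.@[hom (chart (proj k n) j L) ord0].
  by rewrite -(meval_homog_scale _ _ hH) -e.
rewrite /= eH; split=> [/negP|->]; last by rewrite mulr0 eqxx.
by rewrite negbK mulf_eq0 (negPf (expf_neq0 d vj)) => /eqP.
Qed.

Lemma homog_nonzero_line H : H != 0 ->
  exists L v, [/\ v != 0, v \in sval L & H.@[v ord0] != 0].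
Proof.
(* The factor x_0 ensures that the point found is a nonzero vector, even for constant H. *)
move=> H0; have [|v] := @mpoly_nonroot k n.+1 (H * 'X_ord0).
  by rewrite mulf_neq0 // -msize_poly_eq0 msizeX.
rewrite mevalM mulf_eq0 negb_or mevalXU => /andP[Hv v_0].
have v0 : v != 0 by apply: contraNneq v_0 => ->; rewrite mxE.
by have [L hL] := line_through v0; exists L, v.
Qed.

(** Irreducibility of P^n: two nonempty open sets contain the nonvanishing loci of forms H and G,
    and H G is nonzero. *)
Lemma proj_open_dense (W : set (proj k n)) : zopen W -> W !=set0 -> zdense W.
Proof.
move=> oW [L WL] V oV [M VM].
have [H [d [_ hH HW]]] := proj_open_form oW WL.
have [G [e [_ hG GV]]] := proj_open_form oV VM.
have [|N [v [v0 vN]]] := @homog_nonzero_line (H * G).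
  rewrite mulf_neq0 //.
    by apply: contraNneq hH => ->; rewrite meval0.
  by apply: contraNneq hG => ->; rewrite meval0.
rewrite mevalM mulf_eq0 negb_or => /andP[Hv Gv].
by exists N; split; [exact: GV Gv|exact: HW Hv].
Qed.

Lemma proj_dense_neq0 (W : set (proj k n)) : zdense W -> W !=set0.
Proof.
move=> dW; have [L _] := @homog_nonzero_line 1 (oner_neq0 _).
have [M [_ WM]] := dW _ (@zopenT k _) (ex_intro _ L Logic.I); by exists M.
Qed.

Lemma proj_mpoly_eq0 (P H : {mpoly k[n.+1]}) : H != 0 ->
  (forall v L, v != 0 -> v \in sval L -> H.@[v ord0] != 0 -> P.@[v ord0] = 0) ->
  P = 0.
Proof.
move=> H0 h; apply: contrapT => /eqP P0.
have [L [v [v0 vL]]] := homog_nonzero_line (mulf_neq0 H0 P0).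
rewrite mevalM mulf_eq0 negb_or => /andP[Hv].
by rewrite (h v L) // eqxx.
Qed.

End ProjectiveOpens.

(** * Representatives and degree *)

Section Degree.
Variables (k : closedFieldType) (n : nat).
Implicit Types (f : Bir (proj k n)) (F G : 'I_n.+1 -> {mpoly k[n.+1]}).

(* Unlike [given_by], this allows F to vanish identically somewhere on the    *)
(* open set where f is defined.                                               *)
Definition represents f F :=
  exists U g (H : {mpoly k[n.+1]}) d,
    [/\ bir_class f (U, g), H \is d.-homog, H != 0 &
      forall v (L : proj k n), v != 0 -> v \in sval L -> H.@[v ord0] != 0 ->
        U L /\ \row_i (F i).@[v ord0] \in sval (g L)].

Lemma given_by_represents f F : given_by f F -> represents f F.
Proof.
move=> [U [g [cU hF]]]; have [oU dU] := bir_class_open cU.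
have [L1 UL1] := proj_dense_neq0 dU.
have [H [d [hH H1 HU]]] := proj_open_form oU UL1.
exists U, g, H, d; split=> //.
  by apply: contraNneq H1 => ->; rewrite meval0.
move=> v L v0 vL Hv; have UL := HU v L v0 vL Hv; split=> //.
by have [] := hF L UL v vL v0.
Qed.

Lemma represents_given_by f F e : (forall i, F i \is e.-homog) ->
  (exists i, F i != 0) -> represents f F -> given_by f F.
Proof.
move=> hF [i Fi] [U [g [H [d [cU hH H0 hU]]]]].
have HFi := dhomogM hH (hF i); have HF0 := mulf_neq0 H0 Fi.
pose V : set (proj k n) :=
  [set L : proj k n | (H * F i).@[vpick (sval L) ord0] != 0].
have VP (L : proj k n) v : v != 0 -> v \in sval L ->
    V L -> (H * F i).@[v ord0] != 0.
  move=> v0 /(mem_lineP _ v0)[c c0 ec]; rewrite /V /= ec.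
  rewrite (meval_homog_scale _ _ HFi).
  by apply: contraNneq => ->; rewrite mulr0.
have oV : zopen V by exact: homog_zopen HFi.
have V0 : V !=set0.
  have [L [v [v0 vL hv]]] := homog_nonzero_line HF0; exists L.
  have /(mem_lineP _ v0)[c c0 ec] := vL.
  by rewrite /V /= ec (meval_homog_scale _ _ HFi) mulf_neq0 ?expf_neq0.
exists V, g; split.
  apply: (bir_class_subset cU) => //; first exact: proj_open_dense.
  move=> L /(VP _ _ (vpick_line_neq0 L) (memv_pick _)).
  rewrite mevalM mulf_eq0 negb_or => /andP[Hv _].
  by have [] := hU _ L (vpick_line_neq0 L) (memv_pick _) Hv.
move=> L VL v vL v0 /=; have := VP L v v0 vL VL.
rewrite mevalM mulf_eq0 negb_or => /andP[Hv Fv]; split.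
  by apply: contraNneq Fv => /rowP /(_ i); rewrite !mxE => ->.
by have [] := hU _ L v0 vL Hv.
Qed.

(** Both families lie on the same image line over a nonempty open set, so the 2x2 minors vanish
    there, hence identically. *)
Lemma represents_proportional f F G : represents f F -> represents f G ->
  forall i j, F i * G j = F j * G i.
Proof.
move=> [U [g [H [d [cU hH H0 hU]]]]] [U' [g' [H' [d' [cU' hH' H0' hU']]]]] i j.
have [W [oW dW Wg]] := bir_class_agree cU cU'.
have [L1 WL1] := proj_dense_neq0 dW.
have [K [e [_ K1 KW]]] := proj_open_form oW WL1.
have K0 : K != 0 by apply: contraNneq K1 => ->; rewrite meval0.
apply/eqP; rewrite -subr_eq0; apply/eqP.
apply: (proj_mpoly_eq0 (mulf_neq0 (mulf_neq0 H0 H0') K0)) => v L v0 vL.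
rewrite !mevalM !mulf_eq0 !negb_or => /andP[/andP[Hv Hv'] Kv].
have [_ FL] := hU v L v0 vL Hv; have [_ GL] := hU' v L v0 vL Hv'.
rewrite -(Wg L (KW v L v0 vL Kv)) in GL.
have := mem_line_minors FL GL i j; rewrite !mxE => e1.
by rewrite mevalB !mevalM e1 subrr.
Qed.

Lemma represents_of_proportional f F G e : (forall i, F i \is e.-homog) ->
  (exists i, F i != 0) -> represents f F ->
  (forall i j, F i * G j = F j * G i) -> represents f G.
Proof.
move=> hF [i Fi] [U [g [H [d [cU hH H0 hU]]]]] FG.
exists U, g, (H * F i), (d + e)%N; split=> //.
- exact: dhomogM.
- exact: mulf_neq0.
move=> v L v0 vL; rewrite mevalM mulf_eq0 negb_or => /andP[Hv Fv].
have [UL FL] := hU v L v0 vL Hv; split=> //.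
apply: minors_mem_line FL _.
  by apply: contraNneq Fv => /rowP /(_ i); rewrite !mxE => ->.
by move=> a b; rewrite !mxE -!mevalM FG.
Qed.

Lemma no_common_factor_neq0 F : no_common_factor F -> exists i, F i != 0.
Proof.
move=> hF; apply: contrapT => h; have [|c c0 /eqP] := hF 0.
  move=> i; exists 0; rewrite mulr0; apply: contrapT => /eqP Fi.
  by apply: h; exists i.
by rewrite eq_sym mpolyC_eq0 (negPf c0).
Qed.

Lemma homog_msizeE (p : {mpoly k[n.+1]}) d :
  p != 0 -> p \is d.-homog -> msize p = d.+1.
Proof.
move=> p0 hp; rewrite (mpolySpred _ p0); congr _.+1.
by rewrite (dhomog_uniq p0 hp (dhomog_msize hp)).
Qed.

(** By [coprime_family_divides] a nonzero F_j divides G_j, which is nonzero as well; compare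
    degrees. *)
Lemma no_common_factor_degree_min F G d e : no_common_factor F ->
  (forall i, F i \is d.-homog) -> (forall i, G i \is e.-homog) ->
  (exists i, G i != 0) -> (forall i j, F i * G j = F j * G i) -> (d <= e)%N.
Proof.
move=> cF hF hG [i Gi] FG; have [j Fj] := no_common_factor_neq0 cF.
have Gj : G j != 0.
  apply/eqP => Gj; have /eqP := FG i j.
  by rewrite Gj mulr0 eq_sym mulf_eq0 (negPf Fj) (negPf Gi).
have [|c ec] := coprime_family_divides (@factorial_mpoly k n.+1) _ Fj
  (fun i => FG i j).
  move=> p [p0 Np _]; apply: contrapT => /forallNP hp.
  have [|c c0 ep] := cF p; first by move=> l; have /contrapT := hp l.
  case/negP: Np; rewrite ep; apply/unitrPr; exists (c^-1)%:MP.
  by rewrite -mpolyCM divff.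
have c0 : c != 0 by apply: contraNneq Gj => c0; rewrite ec c0 mulr0.
have := msizeM Fj c0; rewrite -ec (homog_msizeE Gj (hG j)).
rewrite (homog_msizeE Fj (hF j)) (mpolySpred _ c0) addSn addnS /= => -[->].
exact: leq_addr.
Qed.

(** Top homogeneous parts multiply. This handles the factors in [no_common_factor], which are not
    assumed homogeneous. *)
Lemma pihomogM_top (p q : {mpoly k[n.+1]}) a b :
  (msize p <= a.+1)%N -> (msize q <= b.+1)%N ->
  pihomog mdeg (a + b) (p * q) = pihomog mdeg a p * pihomog mdeg b q.
Proof.
move=> hp hq; rewrite {1}(pihomog_partitionE hp) {1}(pihomog_partitionE hq).
rewrite mulr_suml linear_sum (bigD1 ord_max) //= [X in _ + X]big1 => [|i ni].
  rewrite addr0 mulr_sumr linear_sum (bigD1 ord_max) //=.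
  rewrite [X in _ + X]big1 => [|j nj].
    by rewrite addr0 pihomog_dE //; apply: dhomogM; exact: pihomogP.
  apply: (@pihomog_ne0 _ _ _ (a + j)%N).
    by move: nj; rewrite -val_eqE /= eqn_add2l.
  by apply: dhomogM; exact: pihomogP.
rewrite mulr_sumr linear_sum big1 // => j _ /=.
apply: (@pihomog_ne0 _ _ _ (i + j)%N).
  by have := ltn_ord i; have := ltn_ord j; move: ni; rewrite -val_eqE /=; lia.
by apply: dhomogM; exact: pihomogP.
Qed.

(** A nonzero representing family of least degree has no common factor: dividing by the top form of
    a nonconstant one would lower the degree. *)
Lemma represents_has_degree f F e : (forall i, F i \is e.-homog) ->
  (exists i, F i != 0) -> represents f F -> exists d, has_degree f d.
Proof.
move=> hF F0 fF.
pose P d := `[< exists G, [/\ forall i, G i \is d.-homog, exists i, G i != 0 &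
  represents f G] >].
have exP : exists d, P d by exists e; apply/asboolP; exists F.
case: (ex_minnP exP) => d /asboolP[{hF F0 fF}F [hF F0 fF]] hmin.
exists d, F; split=> //; last exact: represents_given_by fF.
move=> h /choice[q hq].
have h0 : h != 0.
  by have [i] := F0; rewrite hq; apply: contraNneq => ->; rewrite mul0r.
pose s := (msize h).-1; have sh : msize h = s.+1 by rewrite (mpolySpred _ h0).
have top i : F i = pihomog mdeg s h * pihomog mdeg (d - s) (q i).
  have [Fi|Fi] := eqVneq (F i) 0.
    have /eqP := hq i; rewrite Fi eq_sym mulf_eq0 (negPf h0) /= => /eqP ->.
    by rewrite linear0 mulr0.
  have q0 : q i != 0 by apply: contraNneq Fi => q0; rewrite hq q0 mulr0.
  have := msizeM h0 q0; rewrite -hq (homog_msizeE Fi (hF i)) sh addSn /= => hd.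
  have sd : (s <= d)%N.
    by rewrite -ltnS hd (mpolySpred _ q0) addnS ltnS leq_addr.
  rewrite -pihomogM_top ?sh //; last by rewrite -subSn // hd addKn.
  by rewrite subnKC // -hq pihomog_dE.
have s0 : s = 0%N.
  have [i Fi] := F0.
  have : P (d - s)%N.
    apply/asboolP; exists (fun i => pihomog mdeg (d - s) (q i)); split.
    - by move=> j; exact: pihomogP.
    - by exists i; apply: contraNneq Fi => e0; rewrite top e0 mulr0.
    apply: (represents_of_proportional hF F0 fF) => a b.
    by rewrite !top mulrAC.
  move=> /hmin; have : (s <= d)%N.
    have q0 : q i != 0 by apply: contraNneq Fi => q0; rewrite hq q0 mulr0.
    have := msizeM h0 q0; rewrite -hq (homog_msizeE Fi (hF i)) sh.
    by rewrite (mpolySpred _ q0) addSn addnS /= => -[->]; rewrite leq_addr.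
  by lia.
by apply/msize_poly1P; rewrite sh s0.
Qed.

(** F may have common factors. A representative C without them reaches degree d after multiplication
    by a power of x_0; conversely, C has least degree among the nonzero families of forms
    proportional to F. *)
Lemma bir_degP f F e d : (forall i, F i \is e.-homog) ->
  (exists i, F i != 0) -> represents f F ->
  (bir_deg f <= d)%N <-> exists G, [/\ forall i, G i \is d.-homog,
    exists i, G i != 0 & forall i j, F i * G j = F j * G i].
Proof.
move=> hF F0 fF; have ex := represents_has_degree hF F0 fF.
have [C [hC cC gC]] : has_degree f (bir_deg f) by exact: xgetPex ex.
split=> [le|[G [hG G0 FG]]].
  exists (fun i => C i * 'X_ord0 ^+ (d - bir_deg f)); split.
  - move=> i; rewrite -[X in X.-homog](subnKC le) -[X in (_ + X)%N]mul1n.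
    by apply: dhomogM => //; apply: dhomogMn; rewrite dhomogX; apply/eqP/mdeg1.
  - have [i Ci] := no_common_factor_neq0 cC; exists i.
    by rewrite mulf_neq0 // expf_neq0 // -msize_poly_eq0 msizeX.
  - move=> i j; rewrite !mulrA; congr (_ * _).
    exact: represents_proportional fF (given_by_represents gC) i j.
apply: (no_common_factor_degree_min cC hC hG G0).
apply: represents_proportional (given_by_represents gC) _.
exact: represents_of_proportional hF F0 fF FG.
Qed.

End Degree.

(** * Local presentation of morphisms to Bir(P^n) *)

Lemma spec_meval (k : closedFieldType) m n (G : family k m n)
    (t : 'rV[k]_m) (v : 'rV[k]_n) :
  (spec t G).@[v ord0] = (G.@[fun i => (v ord0 i)%:MP]).@[t ord0].
Proof.
rewrite [G]mpolyE (raddf_sum (spec t)) (raddf_sum (meval (v ord0))).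
rewrite (raddf_sum (meval (fun i => (v ord0 i)%:MP))).
rewrite (raddf_sum (meval (t ord0))); apply: eq_bigr => mu _.
rewrite /= map_mpolyZ map_mpolyX !mevalZ mevalM; congr (_ * _).
rewrite !mevalX rmorph_prod; apply: eq_bigr => i _.
by rewrite rmorphXn /= mevalC.
Qed.

Section LocalPresentation.
Variables (k : closedFieldType) (n : nat) (T : atlas k).
Let P : atlas k := proj k n.

(** In charts j at L0 and j' at its image, f has coordinates [pq l / q l]. Scaling the vector with
    entry 1 at j' by the product of the [q l] clears denominators, and homogenizing in x at a common
    degree D gives the F_a. Where G is nonzero, (t, L) lies in U and these expressions are valid. *)
Lemma local_presentation (U : set (prod_atlas T P)) (f : prod_atlas T P -> P)
    (i : idx T) (t0 : T) :
  regular_map U f -> cdom T i t0 -> slice U t0 !=set0 ->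
  exists e d (F : 'I_n.+1 -> family k (dim i) n.+1)
      (G : family k (dim i) n.+1) (v0 : 'rV[k]_n.+1),
    [/\ forall a, F a \is e.-homog, G \is d.-homog,
        (spec (chart T i t0) G).@[v0 ord0] != 0 &
        forall t v (L : proj k n), cdom T i t -> v != 0 -> v \in sval L ->
          (spec (chart T i t) G).@[v ord0] != 0 ->
          let w := \row_a (spec (chart T i t) (F a)).@[v ord0] in
          [/\ U (t, L), w != 0 & w \in sval (f (t, L))]].
Proof.
move=> rf it0 [L0 UL0].
have [j vj] := vector_coord_neq0 (vpick_line_neq0 L0).
have [j' wj'] := vector_coord_neq0 (vpick_line_neq0 (f (t0, L0))).
have [oW rW] := rf j'; set W := (U `&` _) in oW rW.
have WL0 : W (t0, L0) by [].
have cL0 : cdom (prod_atlas T P) (i, j) (t0, L0) by [].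
have [h h0 hW] := zopen_principal oW WL0 cL0.
have /choice[pq hpq] (l : 'I_n) := rW l (i, j) (t0, L0) WL0 cL0.
have /choice[q hq] (l : 'I_n) := hpq l.
pose Fh (a : 'I_n.+1) : {mpoly k[dim i + n]} :=
  if unlift j' a is Some l then pq l * \prod_(l' | l' != l) q l'
  else \prod_l q l.
pose D := (msize (h * \prod_l q l : {mpoly k[dim i + n]}) +
  \sum_a msize (Fh a))%N.
have /choice[F hF] a : exists H : family k (dim i) n.+1, H \is D.-homog /\
    forall (t : 'rV[k]_(dim i)) (v : 'rV[k]_n.+1), v ord0 j != 0 ->
      (spec t H).@[v ord0] =
      v ord0 j ^+ D * (Fh a).@[row_mx t (affine_part j v) ord0].
  have [|H hH HE] := @homogenization k (dim i) n (Fh a) j D.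
    by apply: leq_trans (leq_addl _ _); rewrite (bigD1 a) //= leq_addr.
  by exists H.
have [G hG GE] := @homogenization k (dim i) n _ j D (leq_addr _ _).
have chE t (v : 'rV[k]_n.+1) (L : proj k n) : v != 0 -> v \in sval L ->
    chart (prod_atlas T P) (i, j) (t, L) =
    row_mx (chart T i t) (affine_part j v).
  by move=> v0 vL; rewrite /= -(chart_mem_line j v0 vL).2.
exists D, (D + 1)%N, F, (G * 'X_j), (vpick (sval L0)); split.
- by move=> a; have [] := hF a.
- by apply: dhomogM => //; rewrite dhomogX; apply/eqP/mdeg1.
- rewrite (rmorphM (spec _)) spec_mpolyX mevalM mevalXU mulf_neq0 // GE //.
  rewrite mulf_neq0 ?expf_neq0 //.
  rewrite -(chE t0 _ L0 (vpick_line_neq0 L0) (memv_pick _)).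
  rewrite mevalM mulf_neq0 // rmorph_prod; apply/prodf_neq0 => l _.
  by have [] := hq l.
move=> t v L it v0 vL; rewrite (rmorphM (spec _)) spec_mpolyX mevalM mevalXU.
rewrite mulf_eq0 negb_or => /andP[Gv v_j].
move: Gv; rewrite GE // mulf_eq0 negb_or => /andP[_].
rewrite -(chE t v L v0 vL) mevalM mulf_eq0 negb_or => /andP[hv].
rewrite rmorph_prod => /prodf_neq0 qv.
have cL : cdom (prod_atlas T P) (i, j) (t, L).
  by split=> //; exact/(chart_mem_line j v0 vL).1.
have WL : W (t, L) by exact: hW hv.
have [UL fL] := WL.
have ql l : (q l).@[chart (prod_atlas T P) (i, j) (t, L) ord0] != 0.
  exact: qv.
set y := f (t, L) in fL *; set u := vpick (sval y).
have uj : u ord0 j' != 0 by exact: fL.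
pose Q := (\prod_l q l).@[chart (prod_atlas T P) (i, j) (t, L) ord0].
have Q0 : Q != 0 by rewrite /Q rmorph_prod; apply/prodf_neq0.
(* c rescales the selected vector u of the image line so that its entry at j' becomes v_j^D Q, as in
   the computed vector. *)
pose c := v ord0 j ^+ D * Q / u ord0 j'.
have c0 : c != 0 by rewrite !mulf_neq0 ?expf_neq0 ?invr_eq0.
have -> : \row_a (spec (chart T i t) (F a)).@[v ord0] = c *: u.
  apply/rowP => a; rewrite !mxE (hF a).2 // -(chE t v L v0 vL) /c -!mulrA.
  congr (_ * _); rewrite /Fh; case: unliftP => [l|] ->; last first.
    by rewrite mulVf ?mulr1.
  have [_ /(_ (t, L) WL cL (ql l))] := hq l; rewrite mxE -/u => e.
  rewrite mevalM /Q [in RHS](bigD1 l) //= [in RHS]mevalM.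
  rewrite [(u _ _)^-1 * _]mulrC e.
  rewrite [RHS]mulrAC; congr (_ * _).
  exact: etrans (esym (divfK (ql l) _)) (mulrC _ _).
split=> //; first by rewrite scaler_eq0 negb_or c0 vpick_line_neq0.
by rewrite memvZ // memv_pick.
Qed.

End LocalPresentation.

(** * Semicontinuity and boundedness of the degree *)

Section DegreeInFamilies.
Variables (k : closedFieldType) (n : nat) (T : atlas k).
Variables (theta : T -> Bir (proj k n)) (theta_mor : bir_morphism theta).

(** Fix v0 at which G is nonzero over t0. Then g(t) = G(t, v0), and wherever g is nonzero, G(t, x)
    is a nonzero form in x. *)
Lemma bir_morphism_local (i : idx T) (t0 : T) : cdom T i t0 ->
  exists e (F : 'I_n.+1 -> family k (dim i) n.+1) (g : {mpoly k[dim i]}),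
    [/\ forall a, F a \is e.-homog, g.@[chart T i t0 ord0] != 0 &
        forall t, cdom T i t -> g.@[chart T i t ord0] != 0 ->
          (exists a, spec (chart T i t) (F a) != 0) /\
          represents (theta t) (fun a => spec (chart T i t) (F a))].
Proof.
move=> it0; have [phi [U [f [[_ dU rf _ _] cth]]]] := theta_mor.
have [e [d [F [G [v0 [hF hG G0 hU]]]]]] :=
  local_presentation rf it0 (proj_dense_neq0 (dU t0)).
exists e, F, G.@[fun a => (v0 ord0 a)%:MP]; split=> //.
  by rewrite -spec_meval.
move=> t it; rewrite -spec_meval => Gt.
have Gt0 : spec (chart T i t) G != 0.
  by apply: contraNneq Gt => ->; rewrite meval0.
split.
  have [L [v [v0' vL Gv]]] := homog_nonzero_line Gt0.
  have [_ /vector_coord_neq0[a]] := hU t v L it v0' vL Gv.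
  rewrite mxE => Fa _; exists a.
  by apply: contraNneq Fa => ->; rewrite meval0.
exists (slice U t), (fun x => f (t, x)), (spec (chart T i t) G), d; split=> //.
  exact: spec_homog.
by move=> v L v0' vL Gv; have [] := hU t v L it v0' vL Gv.
Qed.

Lemma bir_deg_le_closed d : zclosed (theta @^-1` Bir_le k n d).
Proof.
move=> i; apply: zclosed_local => t0 it0.
have [e [F [g [hF g0 hg]]]] := bir_morphism_local it0.
exists g; eexists; split; [exact: g0 | exact: (alg_set_proportional F d) |].
move=> t it gt; have [F0 rF] := hg t it gt.
by apply: bir_degP rF => // a; exact: spec_homog.
Qed.

(** A quasi-compactness argument: each point of the chart has a principal neighbourhood with a
    degree bound, and a sequence of points each avoiding all earlier neighbourhoods would contradict
    the basis theorem. *)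
Lemma bir_deg_bounded (i : idx T) :
  exists D, forall t, cdom T i t -> (bir_deg (theta t) <= D)%N.
Proof.
have /choice[ge hge] t0 : exists ge : {mpoly k[dim i]} * nat, cdom T i t0 ->
    ge.1.@[chart T i t0 ord0] != 0 /\ forall t, cdom T i t ->
      ge.1.@[chart T i t ord0] != 0 -> (bir_deg (theta t) <= ge.2)%N.
  have [it0|?] := pselect (cdom T i t0); last by exists (0, 0%N).
  have [e [F [g [hF g0 hg]]]] := bir_morphism_local it0; exists (g, e) => _.
  split=> // t it gt; have [F0 rF] := hg t it gt.
  have hFt a := spec_homog (chart T i t) (hF a).
  apply/(bir_degP _ hFt F0 rF).
  by exists (fun a => spec (chart T i t) (F a)); split=> // a b; rewrite mulrC.
apply: contrapT => /forallNP unb.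
have /choice[pick hpick] D : exists t, cdom T i t /\ (D < bir_deg (theta t))%N.
  have /existsNP[t /not_implyP[it /negP]] := unb D.
  by rewrite -ltnNge; exists t.
(* The degree at t N exceeds the bounds of all earlier neighbourhoods, so their polynomials vanish
   at t N. For some N the polynomial of t N is a combination of them, yet it is nonzero at t N. *)
pose B N := iter N (fun b => maxn b (ge (pick b)).2) 0%N.
pose t N := pick (B N).
have BE M N : (M < N)%N -> ((ge (t M)).2 <= B N)%N.
  elim: N => // N IH; rewrite ltnS leq_eqVlt => /orP[/eqP ->|/IH h] /=.
    exact: leq_maxr.
  exact: leq_trans h (leq_maxl _ _).
have [N [c eN]] := @noetherian_mpoly k (dim i) (fun N => (ge (t N)).1).
have [itN degN] := hpick (B N).
have [/eqP] := hge _ itN; case; rewrite -/(t N) eN raddf_sum big1 //= => M _.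
rewrite mevalM; have [->|gM] := eqVneq (ge (t M)).1.@[chart T i (t N) ord0] 0.
  by rewrite mulr0.
have [itM _] := hpick (B M).
have [_ /(_ (t N) itN gM)] := hge _ itM.
move=> /leq_trans /(_ (BE _ _ (ltn_ord M))).
by rewrite leqNgt degN.
Qed.

End DegreeInFamilies.

Theorem corollary30 (k : closedFieldType) (n : nat) (hn : (1 <= n)%N) :
  (forall d : nat, bir_closed (Bir_le k n d)) /\
  (forall F : set (Bir (proj k n)),
     bir_closed F <->
     (forall d : nat, (0 < d)%N -> bir_closed (F `&` Bir_le k n d))).
Proof.
split=> [d T theta _ htheta|F]; first exact: bir_deg_le_closed.
split=> [hF d _ T theta hT htheta|hF T theta hT htheta i].
  by apply: zclosedI; [exact: hF | exact: bir_deg_le_closed].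
have [D hD] := bir_deg_bounded htheta i.
(* On chart i, intersecting with [Bir_le] at a level above D changes nothing; D.+1 is positive, as
   the hypothesis requires. *)
have [C hC CE] := hF D.+1 isT T theta hT htheta i.
exists C => // t it; rewrite -CE //; split=> [Ft|[]//].
by split=> //; apply: leqW; exact: hD.
Qed.
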